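(* Let $E$ be a directed graph and $R$ a commutative ring with $1$. For any pair $(f,g)\in\mathscr{D}_{E,R}$ with corresponding ideal $I\trianglelefteq L_R(E)$, the following are equivalent: (1) $I$ is graded. (2) For each $c\in C_u(E)$, $g(c)=f(\overline{c^0},\varnothing)[x,x^{-1}]$. (3) For each $c\in C_u(E)$, $g(c)$ is a graded ideal of $R[x,x^{-1}]$.
   Context: Graphs. A directed graph $E=(E^0,E^1,r,s)$ has vertices $E^0$, edges $E^1$, and range and source maps $r,s:E^1\to E^0$ (arbitrary). A vertex $v$ is an infinite emitter if $s^{-1}(v)$ is infinite, and regular if $s^{-1}(v)$ is finite and nonempty. A path of positive length is $\mu=e_1\cdots e_n$ with $r(e_i)=s(e_{i+1})$; vertices are paths of length $0$; $|\mu|$ is the length and $\mu^0$ the set of vertices of $\mu$. A path $e_1\cdots e_n$ with $n>0$ is closed if $s(e_1)=r(e_n)$; a closed path is simple if $s(e_i)=s(e_1)$ implies $i=1$, and a cycle if $s(e_i)=s(e_j)$ implies $i=j$. An exit of $e_1\cdots e_n$ is an edge $e$ with $s(e)=s(e_i)$, $e\neq e_i$ for some $i$. $L_R(E)$, the Leavitt path algebra, is the universal associative $R$-algebra generated by $E^0\cup E^1\cup\{e^*\mid e\in E^1\}$ subject to: $vw=\delta_{vw}v$; $s(e)e=e=er(e)$; $r(e)e^*=e^*=e^*s(e)$; $e^*f=\delta_{ef}r(e)$; $u=\sum_{e\in s^{-1}(u)}ee^*$ for regular $u$. It is $\mathbb{Z}$-graded with $\deg v=0$, $\deg e=1$, $\deg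 e^*=-1$. $R[x,x^{-1}]$ is $\mathbb{Z}$-graded with $\deg x=1$ (coefficients in degree $0$). An ideal $I$ of a $\mathbb{Z}$-graded ring $\bigoplus_nA_n$ is graded if $I=\bigoplus_n(I\cap A_n)$. Ideals are two-sided; $\mathcal{L}(A)$ is the set of ideals of $A$. Admissible pairs. $H\subseteq E^0$ is hereditary if for every path $\mu$, $s(\mu)\in H$ implies $r(\mu)\in H$; saturated if for every regular $v$, $r(s^{-1}(v))\subseteq H$ implies $v\in H$. $\overline{K}$ is the smallest hereditary saturated subset containing $K\subseteq E^0$. A breaking vertex for a hereditary $H$ is an infinite emitter $v\in E^0\setminus H$ with $0<|s^{-1}(v)\cap r^{-1}(E^0\setminus H)|<\infty$; then $v^H=v-\sum_{e\in s^{-1}(v),\,r(e)\notin H}ee^*$. An admissible pair is $(H,S)$ with $H$ hereditary saturated and $S$ a set of breaking vertices for $H$. The set $\mathscr{T}_E$ of admissible pairs is ordered by $(H_1,S_1)\le(H_2,S_2)$ iff $H_1\subseteq H_2$ and $S_1\subseteq H_2\cup S_2$; it is a complete lattice. $\mathscr{T}_E^*=\mathscr{T}_E\setminus\{(\varnothing,\varnothing)\}$. $\mathscr{F}_{E,R}$ is the set of functions $f:\mathscr{T}_E^*\to\mathcal{L}(R)$ with $f(\bigvee_i(H_i,S_i))=\bigcap_if(H_i,S_i)$ for all nonempty families in $\mathscr{T}_E^*$. Cycles. Two cycles are equivalent if one is a cyclic rotation of the other. $C_u(E)$ is the set of equivalence classes of cycles $c$ such that there is exactly one closed simple path based at $s(c)=r(c)$;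 we write $c\in C_u(E)$ for a representative. $c_\downarrow$ is the hereditary saturated closure of the set of ranges of the exits of $c$. If $c$ is based at $v$ and $p(x)=\sum_na_nx^n\in R[x,x^{-1}]$, then $p(c)=\sum_{n<0}a_n(c^* )^{-n}+a_0v+\sum_{n>0}a_nc^n$, where $(e_1\cdots e_n)^*=e_n^*\cdots e_1^*$. $\mathscr{D}_{E,R}$ is the set of pairs $(f,g)$ where $f\in\mathscr{F}_{E,R}$ and $g:C_u(E)\to\mathcal{L}(R[x,x^{-1}])$ satisfies, for every $c\in C_u(E)$: $g(c)\cap R=f(\overline{c^0},\varnothing)$, and $g(c)\subseteq f(c_\downarrow,\varnothing)[x,x^{-1}]$ if $c_\downarrow\ne\varnothing$; $J[x,x^{-1}]$ is the set of Laurent polynomials with coefficients in $J$. The pair $(f,g)$ and the ideal $I\trianglelefteq L_R(E)$ correspond to each other when $f(H,S)=\{r\in R\mid rv\in I\ \forall v\in H,\ rw^H\in I\ \forall w\in S\}$ for all $(H,S)\in\mathscr{T}_E^*$ and $g(c)=\{p(x)\in R[x,x^{-1}]\mid p(c)\in I\}$ for all $c\in C_u(E)$. *)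

(* Defs.v *)
From HB Require Import structures.
From mathcomp Require Import all_boot all_order all_algebra generic_quotient.
From mathcomp Require Import finmap.
From mathcomp Require Import boolp classical_sets functions cardinality fsbigop.
From mathcomp.multinomials Require Import monalg.

Set Implicit Arguments.
Unset Strict Implicit.
Unset Printing Implicit Defensive.

Import Order.TTheory GRing.Theory.

Local Open Scope classical_set_scope.
Local Open Scope ring_scope.
Local Open Scope quotient_scope.

Record digraph := Digraph {
  vert : Type;
  edge : Type;
  src : edge -> vert;
  rng : edge -> vert }.

(* Classically every type is a choiceType, so that these instances put no
   restriction on the graph. *)
HB.instance Definition _ (E : digraph) := gen_eqMixin (vert E).
HB.instance Definition _ (E : digraph) := gen_choiceMixin (vert E).
HB.instance Definition _ (E : digraph) := gen_eqMixin (edge E).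
HB.instance Definition _ (E : digraph) := gen_choiceMixin (edge E).

Section Graph.
Context {E : digraph}.
Implicit Types (v w : vert E) (e : edge E) (es : seq (edge E)).
Implicit Types (c : vert E * seq (edge E)) (H S K : set (vert E)).

Definition emits v : set (edge E) := [set e | src e = v].
Definition infinite_emitter v := infinite_set (emits v).
Definition regular v := finite_set (emits v) /\ emits v !=set0.

(* A path is a pair [(v, es)] of its source and its list of edges; [(v, [::])]
   is the path of length 0 at [v]. *)
Fixpoint is_path v es : Prop :=
  if es is e :: es' then src e = v /\ is_path (rng e) es' else True.
Definition path_rng v es : vert E := last v (map (@rng E) es).
Definition path_verts c : set (vert E) :=
  [set w | w = c.1 \/ exists2 e, e \in c.2 & w = rng e].

Definition closed_path c :=
  [/\ is_path c.1 c.2, c.2 <> [::] & path_rng c.1 c.2 = c.1].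
Definition simple_closed_path c :=
  closed_path c /\ c.1 \notin map (@src E) (behead c.2).
Definition is_cycle c := closed_path c /\ uniq (map (@src E) c.2).
Definition is_exit c e := exists f, [/\ f \in c.2, src e = src f & e <> f].

Definition hereditary H :=
  forall v es, is_path v es -> H v -> H (path_rng v es).
Definition saturated H :=
  forall v, regular v -> @rng E @` emits v `<=` H -> H v.
Definition hs_closure K : set (vert E) :=
  smallest (fun H => hereditary H /\ saturated H) K.

Definition emits_out H w : set (edge E) := [set e | src e = w /\ ~ H (rng e)].
Definition breaking_vertex H w :=
  [/\ infinite_emitter w, ~ H w, emits_out H w !=set0
    & finite_set (emits_out H w)].

Lemma hs_closureP K : hereditary (hs_closure K) /\ saturated (hs_closure K).
Proof.
split=> [v es p Kv A /= AK|v rv sv A /= AK].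
  by have [[hA _] _] := AK; apply: hA p _; apply: Kv.
by have [[_ sA] _] := AK; apply: sA rv _ => w /sv; apply.
Qed.

Lemma sub_hs_closure K : K `<=` hs_closure K.
Proof. exact: sub_smallest. Qed.

Lemma hs_closure_neq0 K : K !=set0 -> hs_closure K !=set0.
Proof. by move=> [v Kv]; exists v; apply: sub_hs_closure. Qed.

End Graph.

Record adm_pair (E : digraph) := AdmPair {
  adm_H : set (vert E);
  adm_S : set (vert E);
  adm_hs : hereditary adm_H /\ saturated adm_H;
  adm_breaking : adm_S `<=` breaking_vertex adm_H }.

HB.instance Definition _ (E : digraph) := gen_eqMixin (adm_pair E).
HB.instance Definition _ (E : digraph) := gen_choiceMixin (adm_pair E).

Section AdmPairOrder.
Context {E : digraph}.
Implicit Types t u : adm_pair E.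

Definition adm_le t u : bool :=
  `[< adm_H t `<=` adm_H u /\ adm_S t `<=` adm_H u `|` adm_S u >].

Lemma adm_ext t u : adm_H t = adm_H u -> adm_S t = adm_S u -> t = u.
Proof.
case: t u => [H S a b] [H' S' a' b'] /= eH eS; subst H' S'.
by rewrite (Prop_irrelevance a a') (Prop_irrelevance b b').
Qed.

Lemma adm_le_refl : reflexive adm_le.
Proof. by move=> t; apply/asboolP; split=> // v; right. Qed.

Lemma adm_le_anti : antisymmetric adm_le.
Proof.
move=> t u /andP[/asboolP[h1 s1] /asboolP[h2 s2]].
have eH : adm_H t = adm_H u by apply/seteqP.
apply: adm_ext => //; apply/seteqP; split=> v Sv.
  have [_ nH _ _] := adm_breaking Sv.
  by case: (s1 v Sv) => //; rewrite -eH.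
have [_ nH _ _] := adm_breaking Sv.
by case: (s2 v Sv) => //; rewrite eH.
Qed.

Lemma adm_le_trans : transitive adm_le.
Proof.
move=> u t w /asboolP[h1 s1] /asboolP[h2 s2]; apply/asboolP; split.
  exact: subset_trans h1 h2.
by move=> v /s1[/h2|/s2]; [left|].
Qed.

End AdmPairOrder.

Fact adm_display : Order.disp_t. Proof. exact: Order.Disp tt tt. Qed.
HB.instance Definition _ (E : digraph) := Order.Le_isPOrder.Build adm_display
  (adm_pair E) adm_le_refl adm_le_anti adm_le_trans.

Section NonBottom.
Context {E : digraph}.

Lemma hs_set0 : hereditary (@set0 (vert E)) /\ saturated (@set0 (vert E)).
Proof.
by split=> // v [_ [e ve]] sub; apply: (sub (rng e)); exists e.
Qed.

Definition adm0 : adm_pair E := AdmPair hs_set0 (@sub0set _ _).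

Definition adm_nz := {t : adm_pair E | t != adm0}.

Definition closure_pair (K : set (vert E)) : adm_pair E :=
  AdmPair (hs_closureP K) (@sub0set _ _).

Lemma closure_pair_neq0 (K : set (vert E)) :
  hs_closure K !=set0 -> closure_pair K != adm0.
Proof.
move=> Kn0; apply/eqP => /(congr1 (@adm_H E)) /= K0.
by move: Kn0; rewrite K0 => -[].
Qed.

(* The pair $(\overline K, \varnothing)$ when $\overline K$ is nonempty. *)
Definition closure_nz (K : set (vert E)) (Kn0 : hs_closure K !=set0) : adm_nz :=
  exist _ (closure_pair K) (closure_pair_neq0 Kn0).

End NonBottom.
Arguments adm_nz : clear implicits.

Section Cycles.
Context (E : digraph).

Definition cu_cycle := {c : vert E * seq (edge E) |
  `[< is_cycle c /\ exists! p, simple_closed_path p /\ p.1 = c.1 >]}.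

Definition cycle_equiv (c d : cu_cycle) : bool :=
  `[< exists k, (val d).2 = rot k (val c).2 >].

Lemma cycle_equiv_refl : reflexive cycle_equiv.
Proof. by move=> c; apply/asboolP; exists 0%N; rewrite rot0. Qed.

Lemma cycle_equiv_sym : symmetric cycle_equiv.
Proof.
suff h c d : cycle_equiv c d -> cycle_equiv d c.
  by move=> c d; apply/idP/idP => /h.
move=> /asboolP[k dE]; apply/asboolP.
by exists (size (rot k (val c).2) - k)%N; rewrite dE -/(rotr _ _) rotK.
Qed.

Lemma cycle_equiv_trans : transitive cycle_equiv.
Proof.
move=> d c b /asboolP[k dE] /asboolP[l bE]; apply/asboolP.
by rewrite bE dE rot_rot_add; eexists.
Qed.

Canonical cycle_equiv_rel := EquivRel cycle_equiv
  cycle_equiv_refl cycle_equiv_sym cycle_equiv_trans.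

Definition Cu := {eq_quot cycle_equiv_rel}.
HB.instance Definition _ := Choice.on Cu.
HB.instance Definition _ := EqQuotient.on Cu.

(* The representative of a class, as a path with its base vertex; base vertex
   and evaluation depend on this choice, the sets built from it do not. *)
Definition cu_repr (c : Cu) : vert E * seq (edge E) := val (repr c : cu_cycle).

Definition cu_verts (c : Cu) : set (vert E) := path_verts (cu_repr c).

Definition cu_exit_rngs (c : Cu) : set (vert E) :=
  @rng E @` is_exit (cu_repr c).

Lemma cu_closure_neq0 (c : Cu) : hs_closure (cu_verts c) !=set0.
Proof. by apply: hs_closure_neq0; exists (cu_repr c).1; left. Qed.

Definition cu_closure (c : Cu) : adm_nz E := closure_nz (cu_closure_neq0 c).

Definition cu_down (c : Cu) : set (vert E) := hs_closure (cu_exit_rngs c).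

End Cycles.

(* $L_R(E)$ need not have a unit, hence a notion of ideal for a bare additive
   group with a multiplication. *)
Record ideal (A : zmodType) (mul : A -> A -> A) := Ideal {
  ideal_set :> set A;
  ideal0 : ideal_set 0;
  idealB : forall x y, ideal_set x -> ideal_set y -> ideal_set (x - y);
  idealMl : forall a x, ideal_set x -> ideal_set (mul a x);
  idealMr : forall a x, ideal_set x -> ideal_set (mul x a) }.

Definition direct_sum (A : zmodType) (B : int -> set A) (I : set A) :=
  (forall x, I x <-> exists2 y : {fsfun int -> A with 0},
     (forall n, B n (y n)) & x = \sum_(n <- finsupp y) y n) /\
  (forall y z : {fsfun int -> A with 0},
     (forall n, B n (y n)) -> (forall n, B n (z n)) ->
     \sum_(n <- finsupp y) y n = \sum_(n <- finsupp z) z n -> y = z).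

Definition graded (A : zmodType) (comp : int -> set A) (I : set A) :=
  direct_sum (fun n => I `&` comp n) I.

Definition laurent (R : comPzRingType) := {malg R[int]}.
HB.instance Definition _ (R : comPzRingType) := GRing.Zmodule.on (laurent R).

Section Laurent.
Context {R : comPzRingType}.
Implicit Types p q : laurent R.

Definition laurent_mul p q : laurent R :=
  \sum_(i <- msupp p) \sum_(j <- msupp q) << p@_i * q@_j *g i + j >>.

Definition laurentC (a : R) : laurent R := << a *g 0 >>.

Lemma laurent_mulw p q (P Q : {fset int}) :
  (msupp p `<=` P)%fset -> (msupp q `<=` Q)%fset ->
  laurent_mul p q = \sum_(i <- P) \sum_(j <- Q) << p@_i * q@_j *g i + j >>.
Proof.
move=> sP sQ; rewrite /laurent_mul (big_fset_incl _ sP) /=; last first.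
  move=> i _ /mcoeff_outdom ->; rewrite big1 // => j _.
  by rewrite mul0r monalgU0.
apply: eq_bigr => i _; rewrite (big_fset_incl _ sQ) //= => j _ /mcoeff_outdom->.
by rewrite mulr0 monalgU0.
Qed.

Lemma laurent_mulC : commutative laurent_mul.
Proof.
move=> p q; rewrite /laurent_mul exchange_big; apply: eq_bigr => i _.
by apply: eq_bigr => j _; rewrite mulrC addrC.
Qed.

Lemma laurent_mulDl : left_distributive laurent_mul +%R.
Proof.
move=> p q r; set P := (msupp p `|` msupp q)%fset.
rewrite (@laurent_mulw (p + q) r P (msupp r)) ?msuppD_le //.
rewrite (@laurent_mulw p r P (msupp r)) ?fsubsetUl //.
rewrite (@laurent_mulw q r P (msupp r)) ?fsubsetUr //.
rewrite -big_split; apply: eq_bigr => i _; rewrite -big_split.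
by apply: eq_bigr => j _; rewrite mcoeffD mulrDl monalgUD.
Qed.

Lemma laurent_mulDr : right_distributive laurent_mul +%R.
Proof. by move=> p q r; rewrite !(laurent_mulC p) laurent_mulDl. Qed.

Lemma laurent_mul0 p : laurent_mul p 0 = 0.
Proof. by apply: (addrI (laurent_mul p 0)); rewrite -laurent_mulDr !addr0. Qed.

Lemma laurent_mul_suml (I : Type) (s : seq I) (F : I -> laurent R) q :
  laurent_mul (\sum_(i <- s) F i) q = \sum_(i <- s) laurent_mul (F i) q.
Proof.
apply: (big_morph (laurent_mul^~ q)) => [x y|]; first exact: laurent_mulDl.
by rewrite laurent_mulC laurent_mul0.
Qed.

Lemma laurent_mul_sumr (I : Type) (s : seq I) (F : I -> laurent R) q :
  laurent_mul q (\sum_(i <- s) F i) = \sum_(i <- s) laurent_mul q (F i).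
Proof.
by rewrite laurent_mulC laurent_mul_suml; under eq_bigr do rewrite laurent_mulC.
Qed.

Lemma laurent_mulU (a b : R) (i j : int) :
  laurent_mul << a *g i >> << b *g j >> = << a * b *g i + j >>.
Proof.
rewrite (@laurent_mulw _ _ [fset i]%fset [fset j]%fset) ?msuppU_le //.
by rewrite !big_seq_fset1 !mcoeffUU.
Qed.

Lemma laurent_mulA : associative laurent_mul.
Proof.
move=> p q r; pose suml := laurent_mul_suml; pose sumr := laurent_mul_sumr.
rewrite (monalgE p) (suml _ _ _ q) (suml _ _ _ r) (suml _ _ _ (laurent_mul q r)).
apply: eq_bigr => i _; set P := mkmalgU i _.
rewrite (monalgE q) (suml _ _ _ r) (sumr _ _ _ P) (sumr _ _ _ P) (suml _ _ _ r).
apply: eq_bigr => j _; set Q := mkmalgU j _.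
rewrite (monalgE r) (sumr _ _ _ Q) (sumr _ _ _ P) (sumr _ _ _ (laurent_mul P Q)).
by apply: eq_bigr => k _; rewrite !laurent_mulU mulrA addrA.
Qed.

Lemma laurent_mul1 : left_id (laurentC 1) laurent_mul.
Proof.
move=> p; rewrite [in RHS](monalgE p) [in LHS](monalgE p) laurent_mul_sumr.
by apply: eq_bigr => i _; rewrite laurent_mulU mul1r add0r.
Qed.

HB.instance Definition _ := GRing.Zmodule_isComPzRing.Build (laurent R)
  laurent_mulA laurent_mulC laurent_mul1 laurent_mulDl.

Definition laurent_comp (n : int) : set (laurent R) :=
  [set p | exists a : R, p = << a *g n >>].

(* $J[x,x^{-1}]$ *)
Definition laurent_over (J : set R) : set (laurent R) :=
  [set p | forall n : int, J p@_n].

End Laurent.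

(* Associative algebras, not necessarily unital. *)
Record nualg (R : comPzRingType) := NUAlg {
  nua_sort :> lmodType R;
  nua_mul : nua_sort -> nua_sort -> nua_sort;
  nua_mulA : associative nua_mul;
  nua_mulDl : left_distributive nua_mul +%R;
  nua_mulDr : right_distributive nua_mul +%R;
  nua_scaleAl : forall (a : R) x y, nua_mul (a *: x) y = a *: nua_mul x y;
  nua_scaleAr : forall (a : R) x y, nua_mul x (a *: y) = a *: nua_mul x y }.

Record leavitt_family (R : comPzRingType) (E : digraph) (B : nualg R)
    (v : vert E -> B) (e e' : edge E -> B) : Prop := LeavittFamily {
  lf_vv : forall u, nua_mul (v u) (v u) = v u;
  lf_vw : forall u w, u <> w -> nua_mul (v u) (v w) = 0;
  lf_se : forall f, nua_mul (v (src f)) (e f) = e f;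
  lf_er : forall f, nua_mul (e f) (v (rng f)) = e f;
  lf_rg : forall f, nua_mul (v (rng f)) (e' f) = e' f;
  lf_gs : forall f, nua_mul (e' f) (v (src f)) = e' f;
  lf_ee : forall f, nua_mul (e' f) (e f) = v (rng f);
  lf_ef : forall f g, f <> g -> nua_mul (e' f) (e g) = 0;
  lf_ck : forall u, regular u ->
    v u = \sum_(f <- fset_set (emits u)) nua_mul (e f) (e' f) }.

Section Leavitt.
Context (R : comPzRingType) (E : digraph).

(* [leavitt] is the quotient of formal expressions by the least congruence that
   contains the axioms of algebras and the defining relations. *)
Inductive lterm :=
| Tv of vert E | Te of edge E | Tg of edge E
| T0 | Tadd of lterm & lterm | Tscale of R & lterm | Tmul of lterm & lterm.

HB.instance Definition _ := gen_eqMixin lterm.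
HB.instance Definition _ := gen_choiceMixin lterm.

Inductive lteq : lterm -> lterm -> Prop :=
| lteq_refl x : lteq x x
| lteq_sym x y : lteq x y -> lteq y x
| lteq_trans y x z : lteq x y -> lteq y z -> lteq x z
| lteq_add x x' y y' : lteq x x' -> lteq y y' -> lteq (Tadd x y) (Tadd x' y')
| lteq_scale a x x' : lteq x x' -> lteq (Tscale a x) (Tscale a x')
| lteq_mul x x' y y' : lteq x x' -> lteq y y' -> lteq (Tmul x y) (Tmul x' y')
| lteq_addA x y z : lteq (Tadd x (Tadd y z)) (Tadd (Tadd x y) z)
| lteq_addC x y : lteq (Tadd x y) (Tadd y x)
| lteq_add0 x : lteq (Tadd T0 x) x
| lteq_addN x : lteq (Tadd (Tscale (-1) x) x) T0
| lteq_scaleA a b x : lteq (Tscale a (Tscale b x)) (Tscale (a * b) x)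
| lteq_scale1 x : lteq (Tscale 1 x) x
| lteq_scaleDr a x y :
    lteq (Tscale a (Tadd x y)) (Tadd (Tscale a x) (Tscale a y))
| lteq_scaleDl x a b :
    lteq (Tscale (a + b) x) (Tadd (Tscale a x) (Tscale b x))
| lteq_mulA x y z : lteq (Tmul x (Tmul y z)) (Tmul (Tmul x y) z)
| lteq_mulDl x y z : lteq (Tmul (Tadd x y) z) (Tadd (Tmul x z) (Tmul y z))
| lteq_mulDr x y z : lteq (Tmul x (Tadd y z)) (Tadd (Tmul x y) (Tmul x z))
| lteq_scaleAl a x y : lteq (Tmul (Tscale a x) y) (Tscale a (Tmul x y))
| lteq_scaleAr a x y : lteq (Tmul x (Tscale a y)) (Tscale a (Tmul x y))
| lteq_vv u : lteq (Tmul (Tv u) (Tv u)) (Tv u)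
| lteq_vw u w : u <> w -> lteq (Tmul (Tv u) (Tv w)) T0
| lteq_se f : lteq (Tmul (Tv (src f)) (Te f)) (Te f)
| lteq_er f : lteq (Tmul (Te f) (Tv (rng f))) (Te f)
| lteq_rg f : lteq (Tmul (Tv (rng f)) (Tg f)) (Tg f)
| lteq_gs f : lteq (Tmul (Tg f) (Tv (src f))) (Tg f)
| lteq_ee f : lteq (Tmul (Tg f) (Te f)) (Tv (rng f))
| lteq_ef f g : f <> g -> lteq (Tmul (Tg f) (Te g)) T0
| lteq_ck u : regular u -> lteq (Tv u)
    (\big[Tadd/T0]_(f <- fset_set (emits u)) Tmul (Te f) (Tg f)).

Definition lteqb (x y : lterm) : bool := `[< lteq x y >].

Lemma lteqb_refl : reflexive lteqb.
Proof. by move=> x; apply/asboolP; apply: lteq_refl. Qed.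

Lemma lteqb_sym : symmetric lteqb.
Proof. by move=> x y; apply: asbool_equiv_eq; split; apply: lteq_sym. Qed.

Lemma lteqb_trans : transitive lteqb.
Proof.
move=> y x z /asboolP xy /asboolP yz; apply/asboolP.
exact: lteq_trans xy yz.
Qed.

Canonical lteq_equiv := EquivRel lteqb lteqb_refl lteqb_sym lteqb_trans.

Definition leavitt := {eq_quot lteq_equiv}.
HB.instance Definition _ := Choice.on leavitt.
HB.instance Definition _ := EqQuotient.on leavitt.

Definition lpi (t : lterm) : leavitt := \pi_leavitt t.

Lemma lpiW (P : leavitt -> Prop) : (forall t, P (lpi t)) -> forall x, P x.
Proof. by move=> Pt; elim/quotW. Qed.

Lemma lpiP x y : lpi x = lpi y <-> lteq x y.
Proof.
rewrite /lpi; split=> [/eqP|xy]; first by rewrite eqmodE => /asboolP.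
by apply/eqP; rewrite eqmodE; apply/asboolP.
Qed.

Lemma lteq_repr x : lteq (repr (lpi x)) x.
Proof. by apply/lpiP; rewrite /lpi reprK. Qed.

Definition leavitt_add (x y : leavitt) : leavitt := lpi (Tadd (repr x) (repr y)).
Definition leavitt_scale (a : R) (x : leavitt) : leavitt :=
  lpi (Tscale a (repr x)).
Definition leavitt_opp (x : leavitt) : leavitt := leavitt_scale (-1) x.
Definition leavitt_mul (x y : leavitt) : leavitt := lpi (Tmul (repr x) (repr y)).

Lemma lpi_add x y : leavitt_add (lpi x) (lpi y) = lpi (Tadd x y).
Proof. by apply/lpiP/lteq_add; apply: lteq_repr. Qed.

Lemma lpi_scale a x : leavitt_scale a (lpi x) = lpi (Tscale a x).
Proof. by apply/lpiP/lteq_scale; apply: lteq_repr. Qed.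

Lemma lpi_mul x y : leavitt_mul (lpi x) (lpi y) = lpi (Tmul x y).
Proof. by apply/lpiP/lteq_mul; apply: lteq_repr. Qed.

Definition lpiE := (lpi_add, lpi_scale, lpi_mul).

Lemma leavitt_addA : associative leavitt_add.
Proof.
elim/lpiW=> x; elim/lpiW=> y; elim/lpiW=> z; rewrite (lpi_add y z) (lpi_add x y) !lpi_add.
exact/lpiP/lteq_addA.
Qed.

Lemma leavitt_addC : commutative leavitt_add.
Proof.
elim/lpiW=> x; elim/lpiW=> y; rewrite !lpiE; exact/lpiP/lteq_addC.
Qed.

Lemma leavitt_add0 : left_id (lpi T0) leavitt_add.
Proof. elim/lpiW=> x; rewrite !lpiE; exact/lpiP/lteq_add0. Qed.

Lemma leavitt_addN : left_inverse (lpi T0) leavitt_opp leavitt_add.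
Proof.
elim/lpiW=> x; rewrite /leavitt_opp (lpi_scale _ x) lpi_add; exact/lpiP/lteq_addN.
Qed.

HB.instance Definition _ := GRing.isZmodule.Build leavitt
  leavitt_addA leavitt_addC leavitt_add0 leavitt_addN.

Lemma leavitt_scaleA a b x :
  leavitt_scale a (leavitt_scale b x) = leavitt_scale (a * b) x.
Proof. elim/lpiW: x => x; rewrite (lpi_scale b x) !lpi_scale; exact/lpiP/lteq_scaleA. Qed.

Lemma leavitt_scale1 : left_id 1 leavitt_scale.
Proof. elim/lpiW=> x; rewrite !lpiE; exact/lpiP/lteq_scale1. Qed.

Lemma leavitt_scaleDr : right_distributive leavitt_scale +%R.
Proof.
move=> a; elim/lpiW=> x; elim/lpiW=> y.
rewrite -[RHS]/(leavitt_add _ _) -[lpi x + lpi y]/(leavitt_add _ _) (lpi_add x y) !lpi_scale lpi_add.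
exact/lpiP/lteq_scaleDr.
Qed.

Lemma leavitt_scaleDl x : {morph leavitt_scale^~ x : a b / a + b}.
Proof.
move=> a b; elim/lpiW: x => x; rewrite -[RHS]/(leavitt_add _ _) !lpi_scale lpi_add.
exact/lpiP/lteq_scaleDl.
Qed.

HB.instance Definition _ := GRing.Zmodule_isLmodule.Build R leavitt
  leavitt_scaleA leavitt_scale1 leavitt_scaleDr leavitt_scaleDl.

Lemma lpi_addE x y : lpi x + lpi y = lpi (Tadd x y).
Proof. exact: lpi_add. Qed.

Lemma lpi_scaleE a x : a *: lpi x = lpi (Tscale a x).
Proof. exact: lpi_scale. Qed.

Lemma leavitt_mulA : associative leavitt_mul.
Proof.
elim/lpiW=> x; elim/lpiW=> y; elim/lpiW=> z; rewrite (lpi_mul y z) (lpi_mul x y) !lpi_mul.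
exact/lpiP/lteq_mulA.
Qed.

Lemma leavitt_mulDl : left_distributive leavitt_mul +%R.
Proof.
elim/lpiW=> x; elim/lpiW=> y; elim/lpiW=> z; rewrite lpi_addE (lpi_mul x z) (lpi_mul y z) lpi_mul lpi_addE.
exact/lpiP/lteq_mulDl.
Qed.

Lemma leavitt_mulDr : right_distributive leavitt_mul +%R.
Proof.
elim/lpiW=> x; elim/lpiW=> y; elim/lpiW=> z; rewrite lpi_addE (lpi_mul x y) (lpi_mul x z) lpi_mul lpi_addE.
exact/lpiP/lteq_mulDr.
Qed.

Lemma leavitt_scaleAl (a : R) (x y : leavitt) :
  leavitt_mul (a *: x) y = a *: leavitt_mul x y.
Proof.
elim/lpiW: x => x; elim/lpiW: y => y; rewrite lpi_scaleE (lpi_mul x y) lpi_mul lpi_scaleE.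
exact/lpiP/lteq_scaleAl.
Qed.

Lemma leavitt_scaleAr (a : R) (x y : leavitt) :
  leavitt_mul x (a *: y) = a *: leavitt_mul x y.
Proof.
elim/lpiW: x => x; elim/lpiW: y => y; rewrite lpi_scaleE (lpi_mul x y) lpi_mul lpi_scaleE.
exact/lpiP/lteq_scaleAr.
Qed.

Definition leavitt_alg : nualg R := NUAlg leavitt_mulA leavitt_mulDl
  leavitt_mulDr leavitt_scaleAl leavitt_scaleAr.

Definition lvert (u : vert E) : leavitt := lpi (Tv u).
Definition ledge (f : edge E) : leavitt := lpi (Te f).
Definition lghost (f : edge E) : leavitt := lpi (Tg f).

Lemma leavitt_generators : leavitt_family (B := leavitt_alg) lvert ledge lghost.
Proof.
split=> [u|u w uw|f|f|f|f|f|f g fg|u ru]; try by rewrite /= lpi_mul;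
  apply/lpiP; constructor.
rewrite /lvert; have /lpiP -> := lteq_ck ru.
rewrite (@big_morph _ _ lpi 0 +%R T0 Tadd) // => [|x y]; last by rewrite lpi_addE.
by apply: eq_bigr => f _; rewrite /= lpi_mul.
Qed.

Section Universal.
Context (B : nualg R) (v : vert E -> B) (e g : edge E -> B).

Fixpoint lterm_eval (t : lterm) : B :=
  match t with
  | Tv u => v u | Te f => e f | Tg f => g f
  | T0 => 0 | Tadd x y => lterm_eval x + lterm_eval y
  | Tscale a x => a *: lterm_eval x | Tmul x y => nua_mul (lterm_eval x) (lterm_eval y)
  end.

Lemma lterm_eval_lteq : leavitt_family v e g ->
  forall x y, lteq x y -> lterm_eval x = lterm_eval y.
Proof.
move=> [vv vw se er rg gs ee ef ck] x y; elim=> //=; try congruence.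
- by move=> *; rewrite addrA.
- by move=> *; rewrite addrC.
- by move=> *; rewrite add0r.
- by move=> *; rewrite scaleN1r addNr.
- by move=> *; rewrite scalerA.
- by move=> *; rewrite scale1r.
- by move=> *; rewrite scalerDr.
- by move=> *; rewrite scalerDl.
- by move=> *; rewrite nua_mulA.
- by move=> *; rewrite nua_mulDl.
- by move=> *; rewrite nua_mulDr.
- by move=> *; rewrite nua_scaleAl.
- by move=> *; rewrite nua_scaleAr.
- by move=> u /ck ->; elim/big_rec2: _ => //= f a b _ ->.
Qed.

Lemma leavitt_universal : leavitt_family v e g ->
  exists! h : leavitt -> B,
    [/\ linear h, forall x y, h (leavitt_mul x y) = nua_mul (h x) (h y),
        forall u, h (lvert u) = v u, forall f, h (ledge f) = e f
      & forall f, h (lghost f) = g f].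
Proof.
move=> fam; pose ev (x : leavitt) : B := lterm_eval (repr x); exists ev.
have hpi x : ev (lpi x) = lterm_eval x.
  exact/(lterm_eval_lteq fam)/lteq_repr.
split.
  split=> [a x y|x y|u|f|f]; [| |exact: hpi..];
    elim/lpiW: x => x; elim/lpiW: y => y.
    by rewrite lpi_scaleE lpi_addE !hpi.
  by rewrite lpi_mul !hpi.
move=> h [hlin hmul hv he hg]; apply/funext; elim/lpiW=> x; rewrite hpi.
have h0 : h 0 = 0.
  have := hlin (-1) 0 0; rewrite scaleN1r oppr0 addr0 => ->.
  by rewrite scaleN1r addNr.
have hD a b : h (a + b) = h a + h b by have := hlin 1 a b; rewrite !scale1r.
have hZ a b : h (a *: b) = a *: h b by have := hlin a b 0; rewrite h0 !addr0.
elim: x => [u|f|f||x IHx y IHy|a x IHx|x IHx y IHy] /=.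
- by rewrite -hv.
- by rewrite -he.
- by rewrite -hg.
- by rewrite -h0.
- by rewrite -lpi_addE hD IHx IHy.
- by rewrite -lpi_scaleE hZ IHx.
- by rewrite -lpi_mul hmul IHx IHy.
Qed.

End Universal.

Fixpoint path_elt (v : vert E) (es : seq (edge E)) : leavitt :=
  match es with
  | [::] => lvert v
  | [:: e] => ledge e
  | e :: es' => leavitt_mul (ledge e) (path_elt (rng e) es')
  end.

Fixpoint path_star (v : vert E) (es : seq (edge E)) : leavitt :=
  match es with
  | [::] => lvert v
  | [:: e] => lghost e
  | e :: es' => leavitt_mul (path_star (rng e) es') (lghost e)
  end.

(* The powers $c^n$, $n > 0$, and $(c^* )^{-n}$, $n < 0$; the base vertex for
   $n = 0$. *)
Definition cycle_pow (c : vert E * seq (edge E)) (n : int) : leavitt :=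
  match n with
  | Posz k => iterop k leavitt_mul (path_elt c.1 c.2) (lvert c.1)
  | Negz k => iterop k.+1 leavitt_mul (path_star c.1 c.2) (lvert c.1)
  end.

Definition cycle_eval (c : vert E * seq (edge E)) (p : laurent R) : leavitt :=
  \sum_(n <- msupp p) p@_n *: cycle_pow c n.

(* $w^H$; [fset_set] is meaningful because [emits_out H w] is finite when [w] is
   a breaking vertex, the only case in which this is used. *)
Definition breaking_elt (H : set (vert E)) (w : vert E) : leavitt :=
  lvert w - \sum_(e <- fset_set (emits_out H w)) leavitt_mul (ledge e) (lghost e).

(* The homogeneous components: the least family of submodules that contains
   the generators in their degrees and is compatible with products. *)
Inductive leavitt_comp : int -> set leavitt :=
| comp_v u : leavitt_comp 0 (lvert u)
| comp_e f : leavitt_comp 1 (ledge f)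
| comp_g f : leavitt_comp (-1) (lghost f)
| comp_0 n : leavitt_comp n 0
| comp_D n x y : leavitt_comp n x -> leavitt_comp n y -> leavitt_comp n (x + y)
| comp_Z n a x : leavitt_comp n x -> leavitt_comp n (a *: x)
| comp_M m n x y : leavitt_comp m x -> leavitt_comp n y ->
    leavitt_comp (m + n) (leavitt_mul x y).

Definition ring_ideal (A : pzRingType) := ideal (@GRing.mul A).
Definition leavitt_ideal := ideal leavitt_mul.

Definition in_F (f : adm_nz E -> ring_ideal R) :=
  forall (F : set (adm_nz E)) (t : adm_nz E), F !=set0 ->
    supremums [set val u | u in F] (val t) ->
    f t = \bigcap_(u in F) f u :> set R.

Definition in_D (f : adm_nz E -> ring_ideal R)
    (g : Cu E -> ring_ideal (laurent R)) :=
  in_F f /\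
  forall c : Cu E,
    [set a : R | ideal_set (g c) (laurentC a)] = f (cu_closure c) /\
    forall cn0 : cu_down c !=set0,
      g c `<=` laurent_over (f (closure_nz cn0)).

Definition corresponds (f : adm_nz E -> ring_ideal R)
    (g : Cu E -> ring_ideal (laurent R)) (I : leavitt_ideal) :=
  (forall t : adm_nz E, f t = [set a : R |
     (forall v, adm_H (val t) v -> ideal_set I (a *: lvert v)) /\
     (forall w, adm_S (val t) w ->
        ideal_set I (a *: breaking_elt (adm_H (val t)) w))] :> set R) /\
  (forall c : Cu E, g c = [set p : laurent R |
     ideal_set I (cycle_eval (cu_repr c) p)] :> set (laurent R)).

End Leavitt.

(* Main.v *)
(* Let [J] be the set of the elements of [I] whose homogeneous components all
   lie in [I]; assuming (2), [I = J] is proved by reducing an element of [I] to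
   constant terms of polynomials in cycles.

   Write [x] in [I], with range [w], as [y + \sum_(f in F) z_f f^*] with [y] a
   combination of paths and [z_f] involving shorter ghost paths than [x]. By
   induction [x f] lies in [J] for every edge [f] leaving [w]. With
   [d = w - \sum_(f in F) f f^*] one has [x = x d + \sum_(f in F) x f f^*] and
   [x d = y d]; as [y e = x e] for [e] outside [F], the coefficients [r_p] of
   [y] satisfy [r_p e] in [I], whence [r_p d] in [I] and [x d] in [J].

   For a combination of paths ending at [w], multiplying by [p^*] shows that one
   has to prove [r w] in [I] whenever [r w + \sum_i r_i c_i] is in [I], with
   [c_i] closed paths at [w]. If there are two simple closed paths [c] and [d]
   at [w], conjugation by [c^n d] for large [n] kills every [c_i]; if there is
   only one, it is a cycle of [C_u(E)] and the element is a polynomial in it. *)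
Require Import Defs.
From HB Require Import structures.
From mathcomp Require Import all_boot all_order all_algebra generic_quotient.
From mathcomp Require Import finmap.
From mathcomp Require Import boolp classical_sets.
From mathcomp.multinomials Require Import monalg.

Set Implicit Arguments.
Unset Strict Implicit.
Unset Printing Implicit Defensive.

Import GRing.Theory.

Local Open Scope classical_set_scope.
Local Open Scope ring_scope.

(** * Ideals, and gradedness as stability under projections *)

Section Ideal.
Context (A : zmodType) (mul : A -> A -> A) (I : ideal mul).

Lemma idealN x : ideal_set I x -> ideal_set I (- x).
Proof.
by move=> Ix; rewrite -[- x]add0r; apply: idealB => //; apply: ideal0.
Qed.

Lemma idealD x y : ideal_set I x -> ideal_set I y -> ideal_set I (x + y).
Proof.
by move=> Ix Iy; rewrite -(opprK y); apply: idealB => //; apply: idealN.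
Qed.

Lemma ideal_sum (T : eqType) (s : seq T) (F : T -> A) :
  (forall i, i \in s -> ideal_set I (F i)) -> ideal_set I (\sum_(i <- s) F i).
Proof.
move=> sF; rewrite big_seq; apply: big_ind => //; first exact: ideal0.
exact: idealD.
Qed.

(** By the last hypothesis, any decomposition of an element into components from [B] is the one that
    [pr] computes. This gives uniqueness, and it shows that a decomposition inside [I] puts every
    projection into [I]. *)
Lemma graded_projP (B : int -> set A) (pr : A -> {fsfun int -> A with 0}) :
  (forall x n, B n (pr x n)) ->
  (forall x, x = \sum_(n <- finsupp (pr x)) pr x n) ->
  (forall y : {fsfun int -> A with 0}, (forall n, B n (y n)) ->
     pr (\sum_(n <- finsupp y) y n) = y) ->
  graded B (ideal_set I) <-> forall n x, ideal_set I x -> ideal_set I (pr x n).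
Proof.
move=> Bpr sum_pr pr_sum; split=> [[gI _] n x /gI[y Iy ->]|gI].
  by rewrite pr_sum => [|k]; [have [] := Iy n | have [] := Iy k].
split=> [x|y z Iy Iz yz]; last first.
  rewrite -(pr_sum y) ?yz ?pr_sum // => n; last by have [] := Iy n.
  by have [] := Iz n.
split=> [Ix|[y Iy ->]]; last by apply: ideal_sum => n _; have [] := Iy n.
by exists (pr x) => // n; split; [apply: gI | apply: Bpr].
Qed.

End Ideal.

(** * The grading of the Leavitt path algebra *)

Section NonUnital.
Context (R : comPzRingType) (A : nualg R).
Local Notation "x ** y" := (nua_mul x y) (at level 40, left associativity).

Lemma nua_mul0l (x : A) : 0 ** x = 0.
Proof. by apply: (addrI (0 ** x)); rewrite -nua_mulDl !addr0. Qed.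

Lemma nua_mul0r (x : A) : x ** 0 = 0.
Proof. by apply: (addrI (x ** 0)); rewrite -nua_mulDr !addr0. Qed.

Lemma nua_mulNl (x y : A) : (- x) ** y = - (x ** y).
Proof. by apply: (addrI (x ** y)); rewrite -nua_mulDl !subrr nua_mul0l. Qed.

Lemma nua_mulNr (x y : A) : x ** (- y) = - (x ** y).
Proof. by apply: (addrI (x ** y)); rewrite -nua_mulDr !subrr nua_mul0r. Qed.

Lemma nua_mul_suml (T : Type) (s : seq T) (F : T -> A) (y : A) :
  (\sum_(i <- s) F i) ** y = \sum_(i <- s) F i ** y.
Proof.
by apply: (big_morph (fun z : A => z ** y)) => [u v|];
  [exact: nua_mulDl | exact: nua_mul0l].
Qed.

Lemma nua_mul_sumr (T : Type) (s : seq T) (F : T -> A) (y : A) :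
  y ** (\sum_(i <- s) F i) = \sum_(i <- s) y ** F i.
Proof.
by apply: (big_morph (fun z : A => y ** z)) => [u v|];
  [exact: nua_mulDr | exact: nua_mul0r].
Qed.

(* $A[x,x^{-1}]$ *)
Definition lext : Type := {malg A[int]}.
HB.instance Definition _ := GRing.Zmodule.on lext.
Implicit Types p q r : lext.

Definition lext_scale (a : R) p : lext :=
  \sum_(k <- msupp p) << a *: p@_k *g k >>.

Lemma mcoeff_sum_supp (F : A -> A) p (D : {fset int}) k : F 0 = 0 ->
  (msupp p `<=` D)%fset ->
  (\sum_(i <- D) << F p@_i *g i >>)@_k = F p@_k.
Proof.
move=> F0 sD; rewrite raddf_sum /=.
have [kD|kD] := boolP (k \in D).
  rewrite (big_fsetD1 k) //= mcoeffUU big_seq big1 ?addr0 // => i.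
  by rewrite in_fsetD1 mcoeffU => /andP[/negbTE-> _]; rewrite mulr0n.
rewrite big_seq big1 => [|i iD]; last first.
  by rewrite mcoeffU; case: eqP => [ik|]; rewrite ?mulr0n// -ik iD in kD.
by rewrite mcoeff_outdom ?F0 //; apply: contraNN kD => /(fsubsetP sD).
Qed.

Lemma lext_scaleE a p k : (lext_scale a p)@_k = a *: p@_k.
Proof. exact: (mcoeff_sum_supp (F := fun x => a *: x)) (scaler0 _ _) _. Qed.

Lemma lext_scaleA a b p : lext_scale a (lext_scale b p) = lext_scale (a * b) p.
Proof. by apply/malgP => k; rewrite !lext_scaleE scalerA. Qed.

Lemma lext_scale1 : left_id 1 lext_scale.
Proof. by move=> p; apply/malgP => k; rewrite !lext_scaleE scale1r. Qed.

Lemma lext_scaleDr : right_distributive lext_scale +%R.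
Proof.
move=> a p q; apply/malgP => k.
by rewrite !(lext_scaleE, mcoeffD) scalerDr.
Qed.

Lemma lext_scaleDl p : {morph lext_scale^~ p : a b / a + b}.
Proof.
move=> a b; apply/malgP => k.
by rewrite !(lext_scaleE, mcoeffD) scalerDl.
Qed.

HB.instance Definition _ := GRing.Zmodule_isLmodule.Build R lext
  lext_scaleA lext_scale1 lext_scaleDr lext_scaleDl.

Lemma lext_scaleU a (x : A) k :
  a *: (<< x *g k >> : lext) = << a *: x *g k >>.
Proof.
apply/malgP => i; rewrite lext_scaleE !mcoeffU.
by case: eqP; rewrite ?mulr0n ?scaler0.
Qed.

Definition lext_mul p q : lext :=
  \sum_(i <- msupp p) \sum_(j <- msupp q) << p@_i ** q@_j *g i + j >>.

(** Terms outside the supports vanish; the freedom in the index sets lets two products be compared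
    over a common support. *)
Lemma lext_mulw p q (P Q : {fset int}) :
  (msupp p `<=` P)%fset -> (msupp q `<=` Q)%fset ->
  lext_mul p q = \sum_(i <- P) \sum_(j <- Q) << p@_i ** q@_j *g i + j >>.
Proof.
move=> sP sQ; rewrite /lext_mul (big_fset_incl _ sP) /=; last first.
  move=> i _ /mcoeff_outdom ->; rewrite big1 // => j _.
  by rewrite nua_mul0l monalgU0.
apply: eq_bigr => i _; rewrite (big_fset_incl _ sQ) //= => j _ /mcoeff_outdom->.
by rewrite nua_mul0r monalgU0.
Qed.

Lemma lext_mulDl : left_distributive lext_mul +%R.
Proof.
move=> p q r; set P := (msupp p `|` msupp q)%fset.
rewrite (@lext_mulw (p + q) r P (msupp r)) ?msuppD_le //.
rewrite (@lext_mulw p r P (msupp r)) ?fsubsetUl //.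
rewrite (@lext_mulw q r P (msupp r)) ?fsubsetUr //.
rewrite -big_split; apply: eq_bigr => i _; rewrite -big_split.
by apply: eq_bigr => j _; rewrite mcoeffD nua_mulDl monalgUD.
Qed.

Lemma lext_mulDr : right_distributive lext_mul +%R.
Proof.
move=> r p q; set P := (msupp p `|` msupp q)%fset.
rewrite (@lext_mulw r (p + q) (msupp r) P) ?msuppD_le //.
rewrite (@lext_mulw r p (msupp r) P) ?fsubsetUl //.
rewrite (@lext_mulw r q (msupp r) P) ?fsubsetUr //.
rewrite -big_split; apply: eq_bigr => i _; rewrite -big_split.
by apply: eq_bigr => j _; rewrite mcoeffD nua_mulDr monalgUD.
Qed.

Lemma lext_mulUU (x y : A) i j :
  lext_mul << x *g i >> << y *g j >> = << x ** y *g i + j >>.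
Proof.
rewrite (@lext_mulw _ _ [fset i]%fset [fset j]%fset) ?msuppU_le //.
by rewrite !big_seq_fset1 !mcoeffUU.
Qed.

Lemma lext_ind (P : lext -> Prop) :
  P 0 -> (forall p q, P p -> P q -> P (p + q)) ->
  (forall x k, P << x *g k >>) -> forall p, P p.
Proof.
move=> P0 PD PU p; rewrite (monalgE p).
by apply: big_ind => // k _; apply: PU.
Qed.

Lemma lext_mul0l p : lext_mul 0 p = 0.
Proof. by apply: (addrI (lext_mul 0 p)); rewrite -lext_mulDl !addr0. Qed.

Lemma lext_mul0r p : lext_mul p 0 = 0.
Proof. by apply: (addrI (lext_mul p 0)); rewrite -lext_mulDr !addr0. Qed.

Lemma lext_mulA : associative lext_mul.
Proof.
elim/lext_ind => [q r|p p' IHp IHp' q r|x i]; first by rewrite !lext_mul0l.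
  by rewrite !lext_mulDl IHp IHp'.
elim/lext_ind => [r|q q' IHq IHq' r|y j].
- by rewrite !(lext_mul0l, lext_mul0r).
- by rewrite !(lext_mulDl, lext_mulDr) IHq IHq'.
elim/lext_ind => [|r r' IHr IHr'|z k]; first by rewrite !lext_mul0r.
  by rewrite !lext_mulDr IHr IHr'.
by rewrite !lext_mulUU nua_mulA addrA.
Qed.

Lemma lext_scaleAl (a : R) p q : lext_mul (a *: p) q = a *: lext_mul p q.
Proof.
elim/lext_ind: p => [|p p' IHp IHp'|x i].
- by rewrite !(scaler0, lext_mul0l).
- by rewrite scalerDr !lext_mulDl IHp IHp' scalerDr.
elim/lext_ind: q => [|q q' IHq IHq'|y j]; first by rewrite !lext_mul0r scaler0.
  by rewrite !lext_mulDr IHq IHq' scalerDr.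
by rewrite lext_scaleU !lext_mulUU lext_scaleU nua_scaleAl.
Qed.

Lemma lext_scaleAr (a : R) p q : lext_mul p (a *: q) = a *: lext_mul p q.
Proof.
elim/lext_ind: q => [|q q' IHq IHq'|y j].
- by rewrite !(scaler0, lext_mul0r).
- by rewrite scalerDr !lext_mulDr IHq IHq' scalerDr.
elim/lext_ind: p => [|p p' IHp IHp'|x i]; first by rewrite !lext_mul0l scaler0.
  by rewrite !lext_mulDl IHp IHp' scalerDr.
by rewrite lext_scaleU !lext_mulUU lext_scaleU nua_scaleAr.
Qed.

Definition lext_alg : nualg R :=
  NUAlg lext_mulA lext_mulDl lext_mulDr lext_scaleAl lext_scaleAr.

(** Evaluation at $x=1$, a morphism of algebras. Composed with the coaction [ldelta] below it is the
    identity, which writes an element as the sum of its components. *)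
Definition lext_eval1 p : A := \sum_(k <- msupp p) p@_k.

Lemma lext_eval1w p (D : {fset int}) : (msupp p `<=` D)%fset ->
  lext_eval1 p = \sum_(k <- D) p@_k.
Proof.
move=> sD; rewrite /lext_eval1 (big_fset_incl _ sD) //=.
by move=> k _ /mcoeff_outdom.
Qed.

Lemma lext_eval1D p q : lext_eval1 (p + q) = lext_eval1 p + lext_eval1 q.
Proof.
rewrite (lext_eval1w (msuppD_le p q)) (lext_eval1w (fsubsetUl _ (msupp q))).
rewrite (lext_eval1w (fsubsetUr (msupp p) _)) -big_split.
by apply: eq_bigr => k _; rewrite mcoeffD.
Qed.

Lemma lext_eval1U x k : lext_eval1 << x *g k >> = x.
Proof. by rewrite (lext_eval1w msuppU_le) big_seq_fset1 mcoeffUU. Qed.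

Lemma lext_eval10 : lext_eval1 0 = 0.
Proof. by rewrite /lext_eval1 msupp0 big_seq_fset0. Qed.

Lemma lext_eval1Z a p : lext_eval1 (a *: p) = a *: lext_eval1 p.
Proof.
elim/lext_ind: p => [|p q IHp IHq|x k].
- by rewrite scaler0 lext_eval10 scaler0.
- by rewrite scalerDr !lext_eval1D IHp IHq scalerDr.
- by rewrite lext_scaleU !lext_eval1U.
Qed.

Lemma lext_eval1M p q :
  lext_eval1 (lext_mul p q) = lext_eval1 p ** lext_eval1 q.
Proof.
elim/lext_ind: p => [|p p' IHp IHp'|x i].
- by rewrite lext_mul0l lext_eval10 nua_mul0l.
- by rewrite lext_mulDl !lext_eval1D IHp IHp' nua_mulDl.
elim/lext_ind: q => [|q q' IHq IHq'|y j].
- by rewrite lext_mul0r lext_eval10 nua_mul0r.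
- by rewrite lext_mulDr !lext_eval1D IHq IHq' nua_mulDr.
by rewrite lext_mulUU !lext_eval1U.
Qed.

End NonUnital.

(** * The coaction of $L_R(E)$ and the homogeneous components *)

Section Leavitt.
Context (R : comPzRingType) (E : digraph).
Local Notation L := (leavitt R E).
Local Notation "x ** y" := (leavitt_mul x y) (at level 40, left associativity).
Implicit Types (x y z : L) (a b : R) (u v w : vert E) (e : edge E).
Implicit Types (es fs gs : seq (edge E)).

Lemma lmul0l x : 0 ** x = 0.
Proof. exact: (@nua_mul0l _ (leavitt_alg R E)). Qed.

Lemma lmul0r x : x ** 0 = 0.
Proof. exact: (@nua_mul0r _ (leavitt_alg R E)). Qed.

Lemma lmulDl x y z : (x + y) ** z = x ** z + y ** z.
Proof. exact: leavitt_mulDl. Qed.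

Lemma lmulDr x y z : x ** (y + z) = x ** y + x ** z.
Proof. exact: leavitt_mulDr. Qed.

Lemma lmulBl x y z : (x - y) ** z = x ** z - y ** z.
Proof.
by rewrite lmulDl; congr (_ + _); exact: (@nua_mulNl _ (leavitt_alg R E)).
Qed.

Lemma lmulBr x y z : x ** (y - z) = x ** y - x ** z.
Proof.
by rewrite lmulDr; congr (_ + _); exact: (@nua_mulNr _ (leavitt_alg R E)).
Qed.

Lemma lmul_suml (T : Type) (s : seq T) (F : T -> L) y :
  (\sum_(i <- s) F i) ** y = \sum_(i <- s) F i ** y.
Proof. exact: (@nua_mul_suml _ (leavitt_alg R E)). Qed.

Lemma lmul_sumr (T : Type) (s : seq T) (F : T -> L) y :
  y ** (\sum_(i <- s) F i) = \sum_(i <- s) y ** F i.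
Proof. exact: (@nua_mul_sumr _ (leavitt_alg R E)). Qed.

Definition lmulA := @leavitt_mulA R E.
Definition lscaleAl := @leavitt_scaleAl R E.
Definition lscaleAr := @leavitt_scaleAr R E.

Let gens := leavitt_generators R E.
Definition lvv u : lvert R u ** lvert R u = lvert R u := lf_vv gens u.
Definition lvw u w (uw : u <> w) : lvert R u ** lvert R w = 0 := lf_vw gens uw.
Definition lse e : lvert R (src e) ** ledge R e = ledge R e := lf_se gens e.
Definition ler e : ledge R e ** lvert R (rng e) = ledge R e := lf_er gens e.
Definition lrg e : lvert R (rng e) ** lghost R e = lghost R e := lf_rg gens e.
Definition lgs e : lghost R e ** lvert R (src e) = lghost R e := lf_gs gens e.
Definition lee e : lghost R e ** ledge R e = lvert R (rng e) := lf_ee gens e.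
Definition lef e f (ef : e <> f) : lghost R e ** ledge R f = 0 := lf_ef gens ef.

Lemma leavitt_ind (P : L -> Prop) :
  P 0 -> (forall x y, P x -> P y -> P (x + y)) ->
  (forall a x, P x -> P (a *: x)) -> (forall x y, P x -> P y -> P (x ** y)) ->
  (forall u, P (lvert R u)) -> (forall e, P (ledge R e)) ->
  (forall e, P (lghost R e)) -> forall x, P x.
Proof.
move=> P0 PD PZ PM Pv Pe Pg; elim/lpiW.
elim=> [u|f|f||t IHt s IHs|a t IHt|t IHt s IHs].
- exact: Pv.
- exact: Pe.
- exact: Pg.
- exact: P0.
- by rewrite -lpi_addE; apply: PD.
- by rewrite -lpi_scaleE; apply: PZ.
- by rewrite -lpi_mul; apply: PM.
Qed.

Local Notation M := (lext_alg (leavitt_alg R E)).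

(* The coaction [x |-> \sum_n x_n X^n], whose existence makes the components
   independent. *)
Definition ldelta (x : L) : M :=
  lterm_eval (B := M) (fun u => << lvert R u *g 0 >>)
    (fun e => << ledge R e *g 1 >>) (fun e => << lghost R e *g -1 >>) (repr x).

(** Every defining relation is homogeneous for the degrees $0$, $1$, $-1$ of the generators, so it
    survives the insertion of the powers of $X$. *)
Lemma ldelta_family : leavitt_family (B := M)
  (fun u => << lvert R u *g 0 >>)
  (fun e => << ledge R e *g 1 >>) (fun e => << lghost R e *g -1 >>).
Proof.
split=> [u|u w uw|f|f|f|f|f|f g fg|u ru];
  rewrite ?[LHS]lext_mulUU ?(addr0, add0r).
- by rewrite [nua_mul _ _]lvv.
- by rewrite [nua_mul _ _]lvw // monalgU0.
- by rewrite [nua_mul _ _]lse.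
- by rewrite [nua_mul _ _]ler.
- by rewrite [nua_mul _ _]lrg.
- by rewrite [nua_mul _ _]lgs.
- by rewrite [nua_mul _ _]lee addNr.
- by rewrite [nua_mul _ _]lef // monalgU0.
rewrite (lf_ck gens ru) [LHS]raddf_sum.
by apply: eq_bigr => e _; rewrite [RHS]lext_mulUU subrr.
Qed.

Lemma ldelta_lpi t : ldelta (lpi t) =
  lterm_eval (B := M) (fun u => << lvert R u *g 0 >>)
    (fun e => << ledge R e *g 1 >>) (fun e => << lghost R e *g -1 >>) t.
Proof. exact/(lterm_eval_lteq ldelta_family)/lteq_repr. Qed.

Lemma ldelta0 : ldelta 0 = 0.
Proof. exact: (ldelta_lpi (T0 R E)). Qed.

Lemma ldeltaD x y : ldelta (x + y) = ldelta x + ldelta y.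
Proof.
by elim/lpiW: x => x; elim/lpiW: y => y; rewrite lpi_addE !ldelta_lpi.
Qed.

Lemma ldeltaZ a x : ldelta (a *: x) = a *: ldelta x.
Proof. by elim/lpiW: x => x; rewrite lpi_scaleE !ldelta_lpi. Qed.

Lemma ldeltaM x y : ldelta (x ** y) = lext_mul (ldelta x) (ldelta y).
Proof.
by elim/lpiW: x => x; elim/lpiW: y => y; rewrite lpi_mul !ldelta_lpi.
Qed.

Lemma ldelta_v u : ldelta (lvert R u) = << lvert R u *g 0 >>.
Proof. exact: ldelta_lpi. Qed.

Lemma ldelta_e e : ldelta (ledge R e) = << ledge R e *g 1 >>.
Proof. exact: ldelta_lpi. Qed.

Lemma ldelta_g e : ldelta (lghost R e) = << lghost R e *g -1 >>.
Proof. exact: ldelta_lpi. Qed.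

Local Notation comp := (@leavitt_comp R E).

Lemma ldelta_comp n x : comp n x -> ldelta x = << x *g n >>.
Proof.
elim=> {n x} [u|e|e|n|n x y _ IHx _ IHy|n a x _ IHx|m n x y _ IHx _ IHy].
- exact: ldelta_v.
- exact: ldelta_e.
- exact: ldelta_g.
- by rewrite ldelta0 monalgU0.
- by rewrite ldeltaD IHx IHy monalgUD.
- by rewrite ldeltaZ IHx [LHS]lext_scaleU.
- by rewrite ldeltaM IHx IHy lext_mulUU.
Qed.

Definition lproj (n : int) (x : L) : L := (ldelta x)@_n.

Lemma lproj0 n : lproj n 0 = 0.
Proof. by rewrite /lproj ldelta0 mcoeff0. Qed.

Lemma lprojD n x y : lproj n (x + y) = lproj n x + lproj n y.
Proof. by rewrite /lproj ldeltaD mcoeffD. Qed.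

Lemma lprojZ n a x : lproj n (a *: x) = a *: lproj n x.
Proof. by rewrite /lproj ldeltaZ [LHS]lext_scaleE. Qed.

Lemma lproj_sum n (T : Type) (s : seq T) (F : T -> L) :
  lproj n (\sum_(i <- s) F i) = \sum_(i <- s) lproj n (F i).
Proof. by apply: big_morph => [x y|]; [exact: lprojD | exact: lproj0]. Qed.

Lemma lproj_comp m n x : comp n x -> lproj m x = if m == n then x else 0.
Proof.
move=> /ldelta_comp; rewrite /lproj => ->; rewrite mcoeffU eq_sym.
by case: eqP; rewrite ?mulr1n ?mulr0n.
Qed.

Lemma comp_sum n (T : eqType) (s : seq T) (F : T -> L) :
  (forall i, i \in s -> comp n (F i)) -> comp n (\sum_(i <- s) F i).
Proof.
move=> sF; rewrite big_seq; apply: big_ind => //; first exact: comp_0.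
by move=> x y; apply: comp_D.
Qed.

Lemma mcoeff_comp_mul (p q : M) :
  (forall n, comp n p@_n) -> (forall n, comp n q@_n) ->
  forall n, comp n (lext_mul p q)@_n.
Proof.
move=> Cp Cq n; rewrite /lext_mul raddf_sum; apply: comp_sum => i _ /=.
rewrite raddf_sum; apply: comp_sum => j _ /=.
rewrite mcoeffU; case: eqP => [<-|_]; last by rewrite mulr0n; apply: comp_0.
by rewrite mulr1n; apply: comp_M.
Qed.

(** Induction on the generation of [x]: a coefficient of a product in $L_R(E)[X,X^{-1}]$ is a sum of
    products of coefficients whose degrees add up. *)
Lemma lproj_in_comp n x : comp n (lproj n x).
Proof.
have U (m k : int) (y : L) : comp m y -> comp k (<< y *g m >> : M)@_k.
  move=> Cy; rewrite mcoeffU; case: eqP => [<-|_] //.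
  by rewrite mulr0n; apply: comp_0.
move: n; elim/leavitt_ind: x => [|x y IHx IHy|a x IHx|x y IHx IHy|u|e|e] n.
- by rewrite lproj0; apply: comp_0.
- by rewrite lprojD; apply: comp_D.
- by rewrite lprojZ; apply: comp_Z.
- by rewrite /lproj ldeltaM; apply: mcoeff_comp_mul.
- by rewrite /lproj ldelta_v; apply/U/comp_v.
- by rewrite /lproj ldelta_e; apply/U/comp_e.
- by rewrite /lproj ldelta_g; apply/U/comp_g.
Qed.

Lemma sum_lproj x : x = \sum_(n <- msupp (ldelta x)) lproj n x.
Proof.
change (x = lext_eval1 (ldelta x)).
elim/leavitt_ind: x => [|x y IHx IHy|a x IHx|x y IHx IHy|u|e|e].
- by rewrite ldelta0 lext_eval10.
- by rewrite ldeltaD lext_eval1D -IHx -IHy.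
- by rewrite ldeltaZ lext_eval1Z -IHx.
- by rewrite ldeltaM lext_eval1M -IHx -IHy.
- by rewrite ldelta_v lext_eval1U.
- by rewrite ldelta_e lext_eval1U.
- by rewrite ldelta_g lext_eval1U.
Qed.

Lemma lprojMr m n x y : comp m y -> lproj n (x ** y) = lproj (n - m) x ** y.
Proof.
move=> Cy; rewrite {1}(sum_lproj x) lmul_suml lproj_sum.
under eq_bigr => k _ do
  rewrite (lproj_comp n (comp_M (lproj_in_comp k x) Cy)).
transitivity (\sum_(k <- msupp (ldelta x)) lproj (n - m) (lproj k x) ** y).
  apply: eq_bigr => k _; rewrite (lproj_comp _ (lproj_in_comp k x)).
  by rewrite subr_eq; case: eqP => // _; rewrite lmul0l.
by rewrite -lmul_suml -lproj_sum -sum_lproj.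
Qed.

Lemma graded_lproj (I : leavitt_ideal R E) : graded comp (ideal_set I) <->
  forall n x, ideal_set I x -> ideal_set I (lproj n x).
Proof.
(* The components of [x] form the finitely supported function underlying [ldelta x]. *)
apply: (graded_projP I (pr := fun x => malg_val (ldelta x))) => [x n|x|y Cy].
- exact: lproj_in_comp.
- exact: sum_lproj.
apply/fsfunP => m; change (lproj m (\sum_(n <- finsupp y) y n) = y m).
rewrite lproj_sum; under eq_bigr => n _ do rewrite (lproj_comp m (Cy n)).
have [my|my] := boolP (m \in finsupp y).
  rewrite (big_fsetD1 m) //= eqxx big_seq big1 ?addr0 // => n.
  by rewrite in_fsetD1 eq_sym => /andP[/negbTE ->].
rewrite big_seq big1 => [|n ny]; first by rewrite fsfun_dflt.
by case: eqP => // mn; rewrite mn ny in my.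
Qed.

End Leavitt.

(** * Paths and ghost paths *)

Section Paths.
Context (R : comPzRingType) (E : digraph).
Local Notation L := (leavitt R E).
Local Notation "x ** y" := (leavitt_mul x y) (at level 40, left associativity).
Local Notation comp := (@leavitt_comp R E).
Implicit Types (x y z : L) (a b : R) (u v w : vert E) (e : edge E).
Implicit Types (es fs gs : seq (edge E)) (p q : vert E * seq (edge E)).

Lemma is_path_cat v es fs :
  is_path v (es ++ fs) <-> is_path v es /\ is_path (path_rng v es) fs.
Proof.
elim: es v => [|e es IH] v /=; first by split=> [|[]].
split=> [[ve /IH[p1 p2]]|[[ve p1] p2]]; first by [].
by split=> //; apply/IH.
Qed.

Lemma path_rng_cat v es fs :
  path_rng v (es ++ fs) = path_rng (path_rng v es) fs.
Proof. by rewrite /path_rng map_cat last_cat. Qed.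

(** [path_elt] treats the last edge apart; the relation $e\,r(e)=e$ makes the recursion uniform. *)
Lemma path_elt_cons v e es :
  path_elt R v (e :: es) = ledge R e ** path_elt R (rng e) es.
Proof. by case: es => //=; rewrite ler. Qed.

Lemma path_star_cons v e es :
  path_star R v (e :: es) = path_star R (rng e) es ** lghost R e.
Proof. by case: es => //=; rewrite lrg. Qed.

Lemma path_elt_src v es : is_path v es ->
  lvert R v ** path_elt R v es = path_elt R v es.
Proof.
case: es => [_|e es [<- _]]; first exact: lvv.
by rewrite path_elt_cons lmulA lse.
Qed.

Lemma path_elt_rng v es :
  path_elt R v es ** lvert R (path_rng v es) = path_elt R v es.
Proof.
elim: es v => [|e es IH] v; first exact: lvv.
by rewrite path_elt_cons -lmulA -[path_rng _ _]/(path_rng (rng e) es) IH.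
Qed.

Lemma path_star_src v es : is_path v es ->
  path_star R v es ** lvert R v = path_star R v es.
Proof.
case: es => [_|e es [<- _]]; first exact: lvv.
by rewrite path_star_cons -lmulA lgs.
Qed.

Lemma path_elt_cat v es fs : is_path (path_rng v es) fs ->
  path_elt R v (es ++ fs) = path_elt R v es ** path_elt R (path_rng v es) fs.
Proof.
elim: es v => [|e es IH] v pfs; first by rewrite path_elt_src.
by rewrite cat_cons !path_elt_cons -lmulA -IH.
Qed.

Lemma path_star_cat v es fs : is_path (path_rng v es) fs ->
  path_star R v (es ++ fs) = path_star R (path_rng v es) fs ** path_star R v es.
Proof.
elim: es v => [|e es IH] v pfs; first by rewrite path_star_src.
by rewrite cat_cons !path_star_cons lmulA -IH.
Qed.

Lemma path_starK v es : is_path v es ->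
  path_star R v es ** path_elt R v es = lvert R (path_rng v es).
Proof.
elim: es v => [|e es IH] v; first by move=> _; exact: lvv.
move=> [_ pes].
rewrite path_star_cons path_elt_cons -lmulA (lmulA (lghost R e)).
by rewrite lee path_elt_src // IH.
Qed.

Lemma path_star_elt_cat v es fs : is_path v (es ++ fs) ->
  path_star R v es ** path_elt R v (es ++ fs) = path_elt R (path_rng v es) fs.
Proof.
move=> /is_path_cat[pes pfs].
by rewrite path_elt_cat // lmulA path_starK // path_elt_src.
Qed.

Lemma path_star_cat_elt v es fs : is_path v (es ++ fs) ->
  path_star R v (es ++ fs) ** path_elt R v es = path_star R (path_rng v es) fs.
Proof.
move=> /is_path_cat[pes pfs].
by rewrite path_star_cat // -lmulA path_starK // path_star_src.
Qed.

Lemma path_star_elt_neq u v es fs : u <> v -> is_path u es -> is_path v fs ->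
  path_star R u es ** path_elt R v fs = 0.
Proof.
move=> uv pes pfs; rewrite -path_star_src // -(path_elt_src pfs).
by rewrite lmulA -(lmulA _ (lvert R u)) lvw // lmul0r lmul0l.
Qed.

(** First edges are compared: $e^*f=0$ when they differ, and equal ones cancel by $e^*e=r(e)$. *)
Lemma path_star_elt0 v es fs : is_path v es -> is_path v fs ->
  [\/ exists gs, fs = es ++ gs, exists gs, es = fs ++ gs
    | path_star R v es ** path_elt R v fs = 0].
Proof.
elim: es v fs => [|e es IH] v fs pes pfs; first by apply: Or31; exists fs.
case: fs pfs => [|f fs] pfs; first by apply: Or32; exists (e :: es).
rewrite path_star_cons path_elt_cons -lmulA (lmulA (lghost R e)).
have [ef|ef] := pselect (e = f); last first.
  by apply: Or33; rewrite lef // lmul0l lmul0r.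
move: pes pfs; rewrite -ef lee => -[ve pes] [_ pfs]; rewrite path_elt_src //.
case: (IH _ _ pes pfs) => [[gs ->]|[gs ->]|->].
- by apply: Or31; exists gs.
- by apply: Or32; exists gs.
- exact: Or33.
Qed.

Lemma path_elt_comp v es : comp (size es) (path_elt R v es).
Proof.
elim: es v => [|e es IH] v; first exact: comp_v.
rewrite path_elt_cons /= -add1n PoszD.
exact: comp_M (comp_e R e) (IH _).
Qed.

Lemma path_star_comp v es : comp (- (size es)%:Z) (path_star R v es).
Proof.
elim: es v => [|e es IH] v; first by rewrite oppr0; exact: comp_v.
rewrite path_star_cons /= -addn1 PoszD opprD.
exact: comp_M (IH _) (comp_g R e).
Qed.

(** Finite sums of vertices serve as local right units. Quantifying over all larger sets [D] allows
    the sets of two summands to be merged. *)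
Lemma right_units x : exists W : {fset vert E}, forall D : {fset vert E},
  (W `<=` D)%fset -> x = \sum_(w <- D) x ** lvert R w.
Proof.
have one u y : y ** lvert R u = y -> exists W : {fset vert E},
    forall D : {fset vert E}, (W `<=` D)%fset ->
      y = \sum_(w <- D) y ** lvert R w.
  move=> yu; exists [fset u]%fset => D; rewrite fsub1set => uD.
  rewrite (big_fsetD1 u) //= yu big_seq big1 ?addr0 // => w.
  rewrite in_fsetD1 => /andP[/eqP wu _].
  by rewrite -yu -lmulA lvw ?lmul0r // => uw; apply: wu.
elim/leavitt_ind: x => [|x y [W1 IHx] [W2 IHy]|a x [W IH]|x y _ [W IH]|u|e|e].
- by exists fset0 => D _; rewrite big1 // => w _; rewrite lmul0l.
- exists (W1 `|` W2)%fset => D; rewrite fsubUset => /andP[D1 D2].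
  rewrite {1}(IHx D) // {1}(IHy D) // -big_split.
  by apply: eq_bigr => w _; rewrite lmulDl.
- exists W => D /IH {1}->; rewrite scaler_sumr.
  by apply: eq_bigr => w _; rewrite lscaleAl.
- exists W => D /IH {1}->; rewrite lmul_sumr.
  by apply: eq_bigr => w _; rewrite lmulA.
- exact/one/lvv.
- exact/one/ler.
- exact/one/lgs.
Qed.

(** * Combinations of paths and ghost paths ending at a vertex *)

Definition path_to w p := is_path p.1 p.2 /\ path_rng p.1 p.2 = w.

(** Indexing by a finite set makes each path occur once, so that its coefficient can be isolated. *)
Definition path_span w x := exists (A : {fset vert E * seq (edge E)})
  (r : vert E * seq (edge E) -> R), (forall p, p \in A -> path_to w p) /\
    x = \sum_(p <- A) r p *: path_elt R p.1 p.2.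

(* The span of the products [p q^*] with [q] of length at most [N] and source
   [w], sorted by the first edge of [q], so that right multiplication by an edge
   leaving [w] decreases [N]. *)
Fixpoint ghost_span N w x : Prop :=
  if N is N'.+1 then exists y (F : {fset edge E}) (z : edge E -> L),
    [/\ path_span w y,
        forall f, f \in F -> src f = w /\ ghost_span N' (rng f) (z f)
      & x = y + \sum_(f <- F) z f ** lghost R f]
  else path_span w x.

Lemma path_span0 w : path_span w 0.
Proof. by exists fset0, (fun=> 0); split=> //; rewrite big_seq_fset0. Qed.

Lemma path_span1 w p : path_to w p -> path_span w (path_elt R p.1 p.2).
Proof.
move=> wp; exists [fset p]%fset, (fun=> 1); split=> [q|].
  by rewrite in_fset1 => /eqP ->.
by rewrite big_seq_fset1 scale1r.
Qed.

Lemma path_spanZ w a x : path_span w x -> path_span w (a *: x).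
Proof.
move=> [A [r [wA ->]]]; exists A, (fun p => a * r p); split=> //.
by rewrite scaler_sumr; apply: eq_bigr => p _; rewrite scalerA.
Qed.

(** Brings sums over different sets to a common index set, where they are added termwise. *)
Lemma big_fset_mask (T : choiceType) (V : zmodType) (A B : {fset T})
    (F : T -> V) : (A `<=` B)%fset ->
  \sum_(i <- A) F i = \sum_(i <- B) (if i \in A then F i else 0).
Proof.
move=> AB; rewrite -(big_fset_incl _ AB) => [|i _ /negbTE -> //].
by rewrite big_seq [RHS]big_seq; apply: eq_bigr => i ->.
Qed.

Lemma path_spanD w x y : path_span w x -> path_span w y -> path_span w (x + y).
Proof.
move=> [A [r [wA ->]]] [B [s [wB ->]]].
exists (A `|` B)%fset, (fun p => (if p \in A then r p else 0) +
                                 (if p \in B then s p else 0)).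
split=> [p|]; first by rewrite in_fsetU => /orP[/wA|/wB].
rewrite (big_fset_mask _ (fsubsetUl A B)) (big_fset_mask _ (fsubsetUr A B)).
rewrite -big_split; apply: eq_bigr => p _.
by rewrite scalerDl; congr (_ + _); case: ifP => //; rewrite scale0r.
Qed.

Lemma ghost_span_path N w x : path_span w x -> ghost_span N w x.
Proof.
case: N => // N wx; exists x, fset0, (fun=> 0).
by split=> //; rewrite big_seq_fset0 addr0.
Qed.

Lemma ghost_spanD N w x y :
  ghost_span N w x -> ghost_span N w y -> ghost_span N w (x + y).
Proof.
elim: N w x y => [|N IH] w x y; first exact: path_spanD.
move=> [x0 [F [z [wx0 wF ->]]]] [y0 [G [t [wy0 wG ->]]]].
exists (x0 + y0), (F `|` G)%fset, (fun f => (if f \in F then z f else 0) +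
  (if f \in G then t f else 0)); split; first exact: path_spanD.
  have g0 u : ghost_span N u 0 by apply/ghost_span_path/path_span0.
  move=> f; rewrite in_fsetU => fFG; split.
    by case/orP: fFG => [/wF|/wG] [].
  by apply: IH; case: ifP => [|_]; [case/wF|exact: g0|case/wG|exact: g0].
rewrite addrACA (big_fset_mask _ (fsubsetUl F G)).
rewrite (big_fset_mask _ (fsubsetUr F G)).
congr (_ + _); rewrite -big_split; apply: eq_bigr => f _.
by rewrite lmulDl; congr (_ + _); case: ifP => //; rewrite lmul0l.
Qed.

Lemma ghost_spanZ N w a x : ghost_span N w x -> ghost_span N w (a *: x).
Proof.
elim: N w x => [|N IH] w x; first exact: path_spanZ.
move=> [y [F [z [wy wF ->]]]]; exists (a *: y), F, (fun f => a *: z f).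
split=> [|f /wF[fw zf]|]; first exact: path_spanZ.
  by split=> //; apply: IH.
rewrite scalerDr scaler_sumr; congr (_ + _).
by apply: eq_bigr => f _; rewrite lscaleAl.
Qed.

Lemma ghost_spanS N w x : ghost_span N w x -> ghost_span N.+1 w x.
Proof.
elim: N w x => [|N IH] w x; first exact: (@ghost_span_path 1).
move=> [y [F [z [wy wF ->]]]]; exists y, F, z.
by split=> // f /wF[fw zf]; split=> //; apply: IH.
Qed.

Lemma ghost_span_leq M N w x :
  (M <= N)%N -> ghost_span M w x -> ghost_span N w x.
Proof.
move=> /subnK <-; elim: (N - M)%N => // k IH Mx.
by rewrite addSn; apply/ghost_spanS/IH.
Qed.

(** The factor [x] meets only the path $p$ of each product $pq^*$, so the ghost part grows by at
    most one edge. *)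
Lemma ghost_span_lmul x :
  (forall w p, path_to w p -> ghost_span 1 w (x ** path_elt R p.1 p.2)) ->
  forall N w y, ghost_span N w y -> ghost_span N.+1 w (x ** y).
Proof.
move=> xP.
have x0 w y : path_span w y -> ghost_span 1 w (x ** y).
  move=> [A [r [wA ->]]]; rewrite lmul_sumr big_seq.
  apply: (big_ind (ghost_span 1 w)) => [|y1 y2|p pA].
  - exact/ghost_span_path/path_span0.
  - exact: ghost_spanD.
  - by rewrite lscaleAr; apply/ghost_spanZ/xP/wA.
elim=> [|N IH] w y; first exact: x0.
move=> [y0 [F [z [wy0 wF ->]]]]; rewrite lmulDr; apply: ghost_spanD.
  by apply: (@ghost_span_leq 1) => //; apply: x0.
exists 0, F, (fun f => x ** z f); split; first exact: path_span0.
  by move=> f /wF[fw zf]; split=> //; apply: IH.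
by rewrite add0r lmul_sumr; apply: eq_bigr => f _; rewrite lmulA.
Qed.

(** By induction on [x], it remains to multiply a path by a generator. A vertex or an edge in front
    of a path gives a path or $0$. *)
Lemma ghost_span_mul x N w y : ghost_span N w y ->
  exists N', ghost_span N' w (x ** y).
Proof.
have g0 M u : ghost_span M u 0 by apply/ghost_span_path/path_span0.
elim/leavitt_ind: x N w y
  => [|x1 x2 IH1 IH2|a x IH|x1 x2 IH1 IH2|u|e|e] N w y wy.
- by exists N; rewrite lmul0l.
- have [N1 h1] := IH1 _ _ _ wy; have [N2 h2] := IH2 _ _ _ wy.
  exists (maxn N1 N2); rewrite lmulDl.
  by apply: ghost_spanD; [apply: ghost_span_leq h1|apply: ghost_span_leq h2];
    rewrite ?leq_maxl ?leq_maxr.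
- have [N1 h1] := IH _ _ _ wy; exists N1.
  by rewrite lscaleAl; apply: ghost_spanZ.
- have [N2 h2] := IH2 _ _ _ wy; have [N1 h1] := IH1 _ _ _ h2.
  by exists N1; rewrite -lmulA.
- exists N.+1; apply: ghost_span_lmul wy => {}w [v es] [/= pes vw].
  have [->|uv] := pselect (u = v).
    rewrite path_elt_src //.
    exact/(@ghost_span_path 1)/(@path_span1 _ (v, es)).
  by rewrite -(path_elt_src pes) lmulA lvw // lmul0l; apply: (g0 1%N).
- exists N.+1; apply: ghost_span_lmul wy => {}w [v es] [/= pes vw].
  have [ev|ev] := pselect (rng e = v).
    rewrite -ev -(path_elt_cons (src e)); apply: (@ghost_span_path 1).
    apply: (@path_span1 _ (src e, e :: es)).
    by split; [rewrite /= ev|rewrite -vw -ev].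
  rewrite -(path_elt_src pes) lmulA -ler -(lmulA _ (lvert R (rng e))) lvw //.
  by rewrite lmul0r lmul0l; apply: (g0 1%N).
(* A ghost edge survives only in front of a path of length $0$; otherwise it cancels the first edge
   or gives $0$. *)
exists N.+1; apply: ghost_span_lmul wy => {}w [v [|f es]] [/= pes vw].
  have [ev|ev] := pselect (src e = v).
    exists 0, [fset e]%fset, (fun=> lvert R (rng e)).
    split; first exact: path_span0.
      move=> f; rewrite in_fset1 => /eqP ->; split; first by rewrite ev.
      exact: (@path_span1 _ (rng e, [::])).
    by rewrite -ev lgs add0r big_seq_fset1 lrg.
  by rewrite -lgs -lmulA lvw // lmul0r; apply: (g0 1%N).
rewrite -/(path_elt R v (f :: es)) path_elt_cons.
have [ef|ef] := pselect (e = f); last first.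
  by rewrite lmulA lef // lmul0l; apply: (g0 1%N).
rewrite lmulA ef lee; have [_ pes'] := pes; rewrite path_elt_src //.
by apply/(@ghost_span_path 1)/(@path_span1 _ (rng f, es)).
Qed.

Lemma ghost_span_vert x w : exists N, ghost_span N w (x ** lvert R w).
Proof.
apply: (@ghost_span_mul _ 0); exact: (@path_span1 _ (w, [::])).
Qed.

Lemma path_span_rng w x : path_span w x -> x ** lvert R w = x.
Proof.
move=> [A [r [wA ->]]]; rewrite lmul_suml big_seq [RHS]big_seq.
apply: eq_bigr => p /wA[_ pw]; by rewrite lscaleAl -pw path_elt_rng.
Qed.

Lemma path_span_edge w x f : path_span w x -> src f = w ->
  path_span (rng f) (x ** ledge R f).
Proof.
move=> [A [r [wA ->]]] fw; rewrite lmul_suml big_seq.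
apply: (big_ind (path_span (rng f))) => [|y z|p /wA[pp pw]].
- exact: path_span0.
- exact: path_spanD.
rewrite lscaleAl; apply: path_spanZ.
have pf : is_path (path_rng p.1 p.2) [:: f] by rewrite pw.
rewrite -[ledge R f]/(path_elt R (path_rng p.1 p.2) [:: f]) -path_elt_cat //.
apply: (@path_span1 _ (p.1, p.2 ++ [:: f])); split.
  by apply/is_path_cat; split.
by rewrite path_rng_cat.
Qed.

End Paths.

(** * Closed paths *)

Section Loops.
Context (E : digraph).
Implicit Types (u v w : vert E) (e : edge E) (es fs gs cs ds : seq (edge E)).

Lemma path_to_cat w u v es fs : path_to u (w, es) -> path_to v (u, fs) ->
  path_to v (w, es ++ fs).
Proof.
move=> [/= pes <-] [/= pfs <-]; split=> /=; last by rewrite path_rng_cat.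
by apply/is_path_cat.
Qed.

Lemma path_to_catr w v es fs :
  path_to v (w, es ++ fs) -> path_to v (path_rng w es, fs).
Proof. by move=> [/= /is_path_cat[_ pfs]]; rewrite path_rng_cat. Qed.

Lemma simple_loop w cs : simple_closed_path (w, cs) -> path_to w (w, cs).
Proof. by move=> [[]]. Qed.

Lemma simple_neq0 w cs : simple_closed_path (w, cs) -> cs <> [::].
Proof. by move=> [[]]. Qed.

Lemma loop_split w es : path_to w (w, es) -> w \in map (@src E) (behead es) ->
  exists es1 es2, [/\ es = es1 ++ es2, es1 <> [::], es2 <> [::],
                      path_to w (w, es1) & path_to w (w, es2)].
Proof.
case: es => // e es pes /= /mapP[f fes wf].
case/splitPr: fes pes => t1 t2 pes; exists (e :: t1), (f :: t2).
have [/(@is_path_cat _ w (e :: t1))[p1 p2] r2] := pes.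
have r1 : path_rng w (e :: t1) = w by rewrite wf; case: p2 => ->.
rewrite r1 in p2; split=> //; split=> //.
by move: r2; rewrite -cat_cons path_rng_cat r1.
Qed.

(** The first edge of a nonempty [gs] would start at $w$ in the interior of [cs], against
    simplicity. *)
Lemma simple_prefix w cs es gs : simple_closed_path (w, cs) ->
  cs = es ++ gs -> es <> [::] -> path_to w (w, es) -> gs = [::].
Proof.
case: gs => // g gs [[/= pcs _ _] wcs] cE es0 [/= _ res]; case/negP: wcs.
move: pcs; rewrite cE => /is_path_cat[_ [gw _]].
case: es es0 cE res gw => // e es _ _ -> gw /=.
by rewrite map_cat mem_cat /= -gw in_cons eqxx orbT.
Qed.

(** Induction on the length: a path that returns to $w$ before its end is cut there, and the first
    piece is treated instead. *)
Lemma first_return w es : path_to w (w, es) -> es <> [::] ->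
  exists cs gs, [/\ es = cs ++ gs, simple_closed_path (w, cs)
                  & path_to w (w, gs)].
Proof.
have [n] := ubnP (size es); elim: n es => // n IH es /ltnSE les pes es0.
have [wes|wes] := boolP (w \in map (@src E) (behead es)); last first.
  exists es, [::]; rewrite cats0; have [pe re] := pes.
  by split=> //; split.
have [es1 [es2 [esE es10 es20 p1 p2]]] := loop_split pes wes.
have lt1 : (size es1 < n)%N.
  apply: leq_trans les; rewrite esE size_cat -addn1 leq_add2l.
  by case: (es2) es20.
have [cs [gs [es1E sc pg]]] := IH _ lt1 p1 es10.
exists cs, (gs ++ es2); split=> //; first by rewrite esE es1E catA.
exact: path_to_cat pg p2.
Qed.

Definition seq_pow es n := flatten (nseq n es).

Lemma seq_powS es n : seq_pow es n.+1 = es ++ seq_pow es n.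
Proof. by []. Qed.

Lemma seq_powD es m n : seq_pow es (m + n) = seq_pow es m ++ seq_pow es n.
Proof. by rewrite /seq_pow nseqD flatten_cat. Qed.

Lemma size_seq_pow es n : size (seq_pow es n) = (n * size es)%N.
Proof. by elim: n => // n IH; rewrite seq_powS size_cat IH mulSn. Qed.

Lemma seq_pow_rot es fs n :
  es ++ seq_pow (fs ++ es) n = seq_pow (es ++ fs) n ++ es.
Proof.
elim: n => [|n IH]; first by rewrite cats0.
by rewrite !seq_powS -[RHS]catA -IH !catA.
Qed.

Lemma loop_pow w cs n : path_to w (w, cs) -> path_to w (w, seq_pow cs n).
Proof.
move=> wcs; elim: n => [|n IH]; first by split.
by rewrite seq_powS; apply: path_to_cat wcs IH.
Qed.

(** If [es] is nonempty, its last edge ends at $v$; if it is empty, the first edge of [fs] starts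
    both at $w$ and at $v$. *)
Lemma loop_rot_base w v es fs : path_to w (w, es ++ fs) -> es ++ fs <> [::] ->
  path_to v (v, fs ++ es) -> path_rng w es = v.
Proof.
case: es => [|e es] [/= p _] n0 [/= p' r']; last first.
  by rewrite -[RHS]r' path_rng_cat.
by case: fs n0 p p' {r'} => //= f fs _ [<- _] [].
Qed.

(** Copies of [cs] are stripped off while [es] is at least as long as [cs]; a shorter nonempty
    remainder would be a proper closed prefix of [cs], which [simple_prefix] excludes. *)
Lemma prefix_seq_pow w cs n es gs : simple_closed_path (w, cs) ->
  seq_pow cs n = es ++ gs -> path_to w (w, es) -> exists m, es = seq_pow cs m.
Proof.
move=> sc; have cs0 := simple_neq0 sc.
elim: n es => [|n IH] es; first by case: es => // _ _; exists 0%N.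
case: (altP (es =P [::])) => [-> _ _|/eqP es0]; first by exists 0%N.
rewrite seq_powS => esE pes.
have [le|lt] := leqP (size cs) (size es).
  have ecs : es = cs ++ drop (size cs) es.
    rewrite -[LHS](cat_take_drop (size cs)); congr (_ ++ _).
    have := congr1 (take (size cs)) esE.
    by rewrite take_size_cat // takel_cat // => ->.
  have [_ /= rcs] := simple_loop sc.
  have pd : path_to w (path_rng w cs, drop (size cs) es).
    by apply: path_to_catr; rewrite -ecs.
  rewrite rcs in pd; move: esE; rewrite {1}ecs -catA => /eqP.
  rewrite eqseq_cat // eqxx /= => /eqP /IH/(_ pd)[m mE].
  by exists m.+1; rewrite seq_powS -mE.
have csE : cs = es ++ drop (size es) cs.
  rewrite -[LHS](cat_take_drop (size es)); congr (_ ++ _).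
  have := congr1 (take (size es)) esE.
  by rewrite [RHS]take_size_cat // takel_cat // ltnW.
have := simple_prefix sc csE es0 pes => d0.
by move: lt; rewrite csE d0 cats0 ltnn.
Qed.

(** The first return of a nonempty [es] is [cs], and the rest is a shorter closed path. *)
Lemma loop_unique_pow w cs es :
  (forall ds, simple_closed_path (w, ds) -> ds = cs) ->
  path_to w (w, es) -> exists m, es = seq_pow cs m.
Proof.
move=> uc; have [n] := ubnP (size es).
elim: n es => // n IH es /ltnSE les pes.
case: (altP (es =P [::])) => [->|/eqP es0]; first by exists 0%N.
have [ds [gs [esE sd pg]]] := first_return pes es0.
have [|m gE] := IH gs _ pg; last first.
  by exists m.+1; rewrite esE gE (uc _ sd).
apply: leq_trans les; rewrite esE size_cat -add1n leq_add2r.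
by case: (ds) (simple_neq0 sd).
Qed.

(** If two edges $x$ and $y$ of [cs] had the same source, deleting the segment from $x$ up to $y$
    would leave a shorter simple closed path at $w$. *)
Lemma unique_simple_cycle w cs : simple_closed_path (w, cs) ->
  (forall ds, simple_closed_path (w, ds) -> ds = cs) -> is_cycle (w, cs).
Proof.
move=> sc uc; have [clc wcs] := sc; split=> //=; apply: contraT => ncs.
have [a [x [b [y [d [csE xy]]]]]] : exists a x b y d,
    cs = a ++ x :: b ++ y :: d /\ src x = src y.
  elim: (cs) ncs => //= x t IH.
  rewrite negb_and negbK => /orP[/mapP[y yt xy]|/IH].
    by case/splitPr: yt => b d; exists [::], x, b, y, d.
  by move=> [a [z [b [y [d [-> zy]]]]]]; exists (x :: a), z, b, y, d.
have [/= pcs _ rcs] := clc.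
have [pa xa pd] : [/\ is_path w a, src x = path_rng w a & is_path (rng y) d].
  by move: pcs; rewrite csE => /is_path_cat[pa [xa /is_path_cat[_ []]]].
have pyd : is_path (path_rng w a) (y :: d) by split; rewrite // -xy.
(* Otherwise $x$ is the first edge and $y$ starts at $w$ again, against simplicity. *)
have a0 : a <> [::].
  move=> a0; case/negP: wcs; rewrite csE a0 /=; rewrite a0 in xa.
  by rewrite map_cat mem_cat /= -xy -[src x]/(src x) xa in_cons eqxx orbT.
have sd : simple_closed_path (w, a ++ y :: d).
  split; first split=> /=.
  - by apply/is_path_cat.
  - by case: (a).
  - by move: rcs; rewrite csE /path_rng !map_cat !last_cat /= map_cat last_cat.
  case: a a0 csE wcs {pa xa pyd} => // e a _ -> /=.
  rewrite !map_cat !mem_cat /= !in_cons map_cat mem_cat /= in_cons !negb_or.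
  by move=> /and3P[-> _ /andP[_ ->]].
have := congr1 size (uc _ sd); rewrite csE !size_cat /= size_cat /=.
by move=> /addnI [] /eqP; rewrite addnS -addSn -[X in X == _]add0n eqn_add2r.
Qed.

End Loops.

(** * Reduction to constant terms *)

Section Reduction.
Context (R : comPzRingType) (E : digraph) (I : leavitt_ideal R E).
Local Notation L := (leavitt R E).
Local Notation "x ** y" := (leavitt_mul x y) (at level 40, left associativity).
Local Notation comp := (@leavitt_comp R E).
Implicit Types (x y z : L) (a b : R) (u v w : vert E) (e : edge E).
Implicit Types (es fs gs cs : seq (edge E)) (p q : vert E * seq (edge E)).

(** What the reduction uses of (2), stated without [g]. The exponents are positive because only
    combinations of paths are reduced to constant terms. *)
Definition cycle_constant_terms := forall w cs,
  is_cycle (w, cs) -> (exists! p, simple_closed_path p /\ p.1 = w) ->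
  forall a (s : seq (R * nat)), (forall i, i \in s -> (0 < i.2)%N) ->
  ideal_set I (a *: lvert R w +
    \sum_(i <- s) i.1 *: path_elt R w (seq_pow cs i.2)) ->
  ideal_set I (a *: lvert R w).

(** By [simple_prefix], neither of two distinct simple closed paths at $w$ is a prefix of the
    other. *)
Lemma simple_star_elt w cs ds : simple_closed_path (w, cs) ->
  simple_closed_path (w, ds) -> ds <> cs ->
  path_star R w ds ** path_elt R w cs = 0.
Proof.
move=> sc sd dc; have pc := simple_loop sc; have pd := simple_loop sd.
have [/= pc1 _] := pc; have [/= pd1 _] := pd; have c0 := simple_neq0 sc.
case: (path_star_elt0 R pd1 pc1) => [[gs cE]|[gs dE]|//].
  have := simple_prefix sc cE (simple_neq0 sd) pd.
  by move=> g0; case: dc; rewrite cE g0 cats0.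
have := simple_prefix sd dE c0 pc.
by move=> g0; case: dc; rewrite dE g0 cats0.
Qed.

(* For [n] large, conjugation by [c^n d] kills every closed path at [w]: those
   that survive the conjugation by [c^n] are powers of [c], and [d^* c = 0]. *)
Lemma conj_loop_eq0 w cs ds es n : simple_closed_path (w, cs) ->
  simple_closed_path (w, ds) -> ds <> cs ->
  path_to w (w, es) -> es <> [::] -> (size es < n)%N ->
  path_star R w (seq_pow cs n ++ ds) ** path_elt R w es **
    path_elt R w (seq_pow cs n ++ ds) = 0.
Proof.
move=> sc sd dc pes es0 ltn; have pc := simple_loop sc.
have [/= pd1 rd] := simple_loop sd; have [/= pn rn] := loop_pow n pc.
have [/= pe re] := pes; have pd2 := pd1; rewrite -rn in pd2.
rewrite path_star_cat // path_elt_cat // rn.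
case: (path_star_elt0 R pn pe) => [[gs eE]|[gs nE]|s0].
(* The power $c^n$ has length at least $n$, so it is not a prefix of [es]. *)
- move: ltn; rewrite eE size_cat size_seq_pow.
  have : (0 < size cs)%N by case: (cs) (simple_neq0 sc).
  case: (size cs) => // k _; rewrite mulnS -addnA ltnNge.
  by rewrite leq_addr.
(* Here [es] is some $c^{m+1}$, which commutes with $c^n$; the conjugate is $d^*c^{m+1}d$, which
   contains $d^*c=0$. *)
- have [[|m] mE] := prefix_seq_pow sc nE pes; first by rewrite mE in es0.
  have [/= pm rm] := loop_pow m pc; have [/= pc1 rc] := pc.
  have [/= pm1 rm1] := loop_pow m.+1 pc.
  have sw : path_elt R w (seq_pow cs m.+1) ** path_elt R w (seq_pow cs n) =
      path_elt R w (seq_pow cs n) ** path_elt R w (seq_pow cs m.+1).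
    rewrite -{2}rm1 -path_elt_cat ?rm1 // -seq_powD addnC seq_powD.
    by rewrite path_elt_cat ?rn.
  rewrite mE !lmulA -(lmulA _ (path_elt R w (seq_pow cs m.+1))) sw lmulA.
  rewrite -(lmulA (path_star R w ds)) path_starK // rn.
  rewrite -(lmulA _ (lvert R w)) path_elt_src // seq_powS path_elt_cat ?rc //.
  by rewrite lmulA simple_star_elt // !lmul0l.
by rewrite -(lmulA (path_star R w ds)) s0 lmul0r lmul0l.
Qed.

Lemma constant_term w a (s : seq (R * seq (edge E))) :
  cycle_constant_terms ->
  (forall i, i \in s -> path_to w (w, i.2) /\ i.2 <> [::]) ->
  ideal_set I (a *: lvert R w + \sum_(i <- s) i.1 *: path_elt R w i.2) ->
  ideal_set I (a *: lvert R w).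
Proof.
move=> Hcyc ss Is.
case: s => [|i0 s0] in ss Is *; first by move: Is; rewrite big_nil addr0.
have [pi0 ni0] := ss i0 (mem_head _ _); set s := i0 :: s0 in ss Is.
have [cs [_ [_ sc _]]] := first_return pi0 ni0; have pc := simple_loop sc.
have [uc|] := pselect (forall ds, simple_closed_path (w, ds) -> ds = cs).
  have cyc := unique_simple_cycle sc uc.
  (* All closed paths at $w$ are powers of [cs]; the exponent is recovered from the length. *)
  apply: (Hcyc w cs cyc _ a [seq (i.1, (size i.2 %/ size cs)%N) | i <- s]).
  - exists (w, cs); split=> // -[v ds] [sd /= vw].
    by rewrite vw in sd *; rewrite (uc _ sd).
  - move=> _ /mapP[i /ss[pi ni] ->] /=.
    have [[|m] mE] := loop_unique_pow uc pi; first by rewrite mE in ni.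
    rewrite mE size_seq_pow mulnK //; by case: (cs) (simple_neq0 sc).
  rewrite big_map; congr (ideal_set I (_ + _)): Is.
  rewrite big_seq [RHS]big_seq; apply: eq_bigr => i /ss[pi ni] /=.
  congr (_ *: path_elt R w _); have [m ->] := loop_unique_pow uc pi.
  by rewrite size_seq_pow mulnK //; case: (cs) (simple_neq0 sc).
move=> /existsNP[ds /not_implyP[sd dc]].
(* One exponent beyond all the lengths in [s], so that a single conjugation kills every closed
   path. *)
pose n := (\max_(i <- s) size i.2).+1; set d := seq_pow cs n ++ ds.
have [/= pd rd] : path_to w (w, d).
  exact: path_to_cat (loop_pow n pc) (simple_loop sd).
have := Defs.idealMr (path_elt R w d) (idealMl (path_star R w d) Is).
rewrite lmulDr lmulDl lscaleAr lscaleAl path_star_src // path_starK // rd.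
rewrite lmul_sumr lmul_suml big_seq big1 ?addr0 // => i si.
have [pi ni] := ss i si; rewrite lscaleAr lscaleAl.
rewrite conj_loop_eq0 ?scaler0 // ltnS.
by rewrite (big_rem i) //= leq_maxl.
Qed.

(** Both paths end at $w$, so the rest of the longer one is a closed path at $w$, nonempty as the
    paths differ. Its first edge is displayed in order to be compared with the set [F] of ghost
    edges later. *)
Lemma path_star_elt_cases w p q : path_to w p -> path_to w q -> q != p ->
  [\/ exists e gs, [/\ q.1 = p.1, q.2 = p.2 ++ e :: gs, src e = w,
         path_to w (w, e :: gs)
       & path_star R p.1 p.2 ** path_elt R q.1 q.2 = path_elt R w (e :: gs)],
      exists e gs, [/\ q.1 = p.1, p.2 = q.2 ++ e :: gs, src e = w
       & path_star R p.1 p.2 ** path_elt R q.1 q.2 = path_star R w (e :: gs)]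
    | path_star R p.1 p.2 ** path_elt R q.1 q.2 = 0].
Proof.
case: p q => [v es] [u fs] [/= pes res] [/= pfs rfs] qp.
have [vu|uv] := pselect (v = u); last by apply: Or33; rewrite path_star_elt_neq.
rewrite -{}vu in pfs rfs qp *.
case: (path_star_elt0 R pes pfs) => [[gs fE]|[gs eE]|->]; last exact: Or33.
  case: gs => [|e gs] in fE *; first by rewrite fE cats0 eqxx in qp.
  have := pfs; rewrite fE => /is_path_cat[_]; rewrite res => pgs.
  have := pgs => -[ew _].
  apply: Or31; exists e, gs; split=> //.
    by split=> //=; move: rfs; rewrite fE path_rng_cat res.
  by rewrite path_star_elt_cat ?res // -fE.
case: gs => [|e gs] in eE *; first by rewrite eE cats0 eqxx in qp.
have := pes; rewrite eE => /is_path_cat[_]; rewrite rfs => -[ew _].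
apply: Or32; exists e, gs; split=> //.
by rewrite path_star_cat_elt ?rfs // -eE.
Qed.

Lemma scale_edge_path a e v es x : ideal_set I (a *: (x ** ledge R e)) ->
  ideal_set I (a *: (x ** path_elt R v (e :: es))).
Proof.
by move=> Ie; rewrite path_elt_cons lmulA -lscaleAl; apply: Defs.idealMr.
Qed.

(** Induction on the length of $p$. Multiplication by $p^*$ makes $r_p$ the constant term: proper
    extensions of $p$ become closed paths, proper prefixes have coefficients already treated, and
    all other paths vanish. *)
Lemma path_span_coef w (A : {fset vert E * seq (edge E)}) (r : _ -> R) :
  cycle_constant_terms -> (forall p, p \in A -> path_to w p) ->
  ideal_set I (\sum_(p <- A) r p *: path_elt R p.1 p.2) ->
  forall p, p \in A -> ideal_set I (r p *: lvert R w).
Proof.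
move=> Hcyc wA IA p; have [n] := ubnP (size p.2).
elim: n p => // n IH p /ltnSE lep pA.
have wp := wA p pA; have [pp rp] := wp.
(* The proper extensions of [p]; they form the non-constant part [S1]. *)
pose K q := [&& q.1 == p.1, prefix p.2 q.2 & q.2 != p.2].
have := idealMl (path_star R p.1 p.2) IA.
rewrite lmul_sumr (big_fsetD1 p) //= lscaleAr path_starK // rp.
rewrite (bigID K) /= addrA.
set S1 := (X in _ + X + _); set S2 := (X in _ + X) => IS.
have IS2 : ideal_set I S2.
  rewrite /S2 big_seq_cond.
  apply: big_ind => [||q]; [exact: ideal0|exact: idealD|].
  rewrite in_fsetD1 => /andP[/andP[qp qA] nK]; rewrite lscaleAr.
  case: (path_star_elt_cases wp (wA q qA) qp)
    => [[e [gs [q1 q2 _ _ _]]]|[e [gs [q1 p2 ew ->]]]|->].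
  - case/negP: nK; rewrite /K q1 q2 eqxx prefix_prefix /=.
    apply/eqP => /(congr1 size)/eqP.
    by rewrite size_cat -[X in _ == X]addn0 eqn_add2l.
  (* Here [q] is a proper prefix of [p], and the induction hypothesis applies to its coefficient. *)
  - have Iq : ideal_set I (r q *: lvert R w).
      apply: IH => //; apply: leq_trans lep.
      by rewrite p2 size_cat -[X in (X < _)%N]addn0 ltn_add2l.
    have := idealMl (path_star R w (e :: gs)) Iq.
    rewrite lscaleAr path_star_src //.
    have [/= pes _] := wp; move: pes; rewrite p2 => /is_path_cat[_].
    by rewrite -q1; have [_ ->] := wA q qA; case.
  - by rewrite scaler0; exact: ideal0.
have IS1 : ideal_set I (r p *: lvert R w + S1).
  by rewrite -[_ + S1](addrK S2); apply: idealB.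
pose s := [seq (r q, drop (size p.2) q.2) | q <- enum_fset (A `\ p)%fset & K q].
apply: (constant_term (s := s) Hcyc).
  move=> i /mapP[q]; rewrite mem_filter => /andP[Kq qA] -> /=.
  move: qA; rewrite in_fsetD1 => /andP[qp /wA wq].
  case/and3P: Kq => /eqP q1 /prefixP[gs q2] n2.
  rewrite q2 drop_size_cat //; split; last first.
    by move=> g0; rewrite q2 g0 cats0 eqxx in n2.
  rewrite -rp; apply: path_to_catr; rewrite -q2 rp -q1.
  by case: (q) wq.
congr (ideal_set I (_ + _)): IS1; rewrite big_map big_filter /S1.
rewrite big_seq_cond [RHS]big_seq_cond; apply: eq_bigr => q /andP[].
rewrite in_fsetD1 => /andP[_ /wA[pq _]] /and3P[/eqP q1 /prefixP[gs q2] _] /=.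
rewrite lscaleAr q1 q2 drop_size_cat // path_star_elt_cat ?rp //.
by rewrite -q2 -q1.
Qed.

(** * Induction on the length of the ghost paths *)

Lemma ghost_span_rng N w x : ghost_span N w x -> x ** lvert R w = x.
Proof.
case: N => [|N]; first exact: path_span_rng.
move=> [y [F [z [wy wF ->]]]]; rewrite lmulDl path_span_rng //; congr (_ + _).
rewrite lmul_suml big_seq [RHS]big_seq; apply: eq_bigr => f /wF[<- _].
by rewrite -lmulA lgs.
Qed.

Lemma ghost_sum_edge w (F : {fset edge E}) (z : edge E -> L) e :
  (forall f, f \in F -> z f ** lvert R (rng f) = z f) ->
  (\sum_(f <- F) z f ** lghost R f) ** ledge R e = if e \in F then z e else 0.
Proof.
move=> zF; rewrite lmul_suml; have [eF|eF] := boolP (e \in F).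
  rewrite (big_fsetD1 e) //= -lmulA lee zF // big_seq big1 ?addr0 // => f.
  by rewrite in_fsetD1 => /andP[/eqP fe _]; rewrite -lmulA lef // lmul0r.
rewrite big_seq big1 // => f fF; rewrite -lmulA lef ?lmul0r // => fe.
by rewrite -fe fF in eF.
Qed.

Definition ghost_defect w (F : {fset edge E}) : L :=
  lvert R w - \sum_(f <- F) ledge R f ** lghost R f.

Section Defect.
Context (w : vert E) (F : {fset edge E}) (wF : forall f, f \in F -> src f = w).
Local Notation d := (ghost_defect w F).

Lemma defect_edge f : f \in F -> d ** ledge R f = 0.
Proof.
move=> fF; rewrite lmulBl (ghost_sum_edge w) => [|g _]; last exact: ler.
by rewrite fF -(wF fF) lse subrr.
Qed.

Lemma ghost_defect0 f : f \in F -> lghost R f ** d = 0.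
Proof.
move=> fF; rewrite lmulBr -(wF fF) lgs lmul_sumr (big_fsetD1 f) //=.
rewrite lmulA lee lrg big_seq big1 ?addr0 ?subrr // => g.
rewrite in_fsetD1 => /andP[/eqP gf _]; rewrite lmulA lef ?lmul0l // => fg.
exact: gf.
Qed.

Lemma defect_vert : d ** lvert R w = d.
Proof.
rewrite lmulBl lvv lmul_suml; congr (_ - _).
rewrite big_seq [RHS]big_seq; apply: eq_bigr => f /wF fw.
by rewrite -lmulA -fw lgs.
Qed.

(** In $dd=dw-\sum_f dff^*$ the sum vanishes, since $df=0$ for $f$ in [F]. *)
Lemma defect_idem : d ** d = d.
Proof.
rewrite {2}/ghost_defect lmulBr defect_vert lmul_sumr big_seq.
rewrite big1 ?subr0 // => f fF.
by rewrite lmulA defect_edge // lmul0l.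
Qed.

Lemma defect_comp : comp 0 d.
Proof.
rewrite /ghost_defect -scaleN1r; apply: comp_D; first exact: comp_v.
apply/comp_Z/comp_sum => f _; rewrite -(subrr 1).
exact: comp_M (comp_e R f) (comp_g R f).
Qed.

End Defect.

Lemma graded_path_span w x : cycle_constant_terms ->
  path_span w x -> ideal_set I x -> forall n, ideal_set I (lproj n x).
Proof.
move=> Hcyc [A [r [wA ->]]] Ix n; rewrite lproj_sum; apply: ideal_sum => p pA.
rewrite lprojZ (lproj_comp _ (path_elt_comp _ _ _)).
case: eqP => _; last by rewrite scaler0; exact: ideal0.
rewrite -(path_elt_rng R p.1 p.2) -lscaleAr; apply: idealMl.
by have [_ ->] := wA p pA; apply: path_span_coef Hcyc wA Ix _ pA.
Qed.

Lemma graded_ghost_span N w x : cycle_constant_terms ->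
  ghost_span N w x -> ideal_set I x -> forall n, ideal_set I (lproj n x).
Proof.
move=> Hcyc; elim: N w x => [|N IH] w x; first exact: graded_path_span.
move=> wx Ix; have xw := ghost_span_rng wx.
have [y [F [z [wy wF xE]]]] := wx; have [A [r [wA yE]]] := wy.
have wF1 f : f \in F -> src f = w by move=> /wF[].
(* Since $f^*e=0$ for $f\neq e$, the edge $e$ removes one ghost edge from the term of $e$ and kills
   the other terms. *)
have xe e : x ** ledge R e = y ** ledge R e + (if e \in F then z e else 0).
  rewrite xE lmulDl (ghost_sum_edge w) // => f /wF[_].
  exact: ghost_span_rng.
have Ixe e n : src e = w -> ideal_set I (lproj n (x ** ledge R e)).
  move=> ew; apply: (IH (rng e)); last exact: Defs.idealMr.
  rewrite xe; apply: ghost_spanD.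
    exact: ghost_span_path (path_span_edge wy ew).
  by case: ifP => [/wF[]|_] //; apply: ghost_span_path; apply: path_span0.
(* For $e$ outside [F], the component of $xe=ye$ in degree $|p|+1$ involves only the paths of length
   $|p|$; among these $p^*$ leaves $p$ alone. *)
have Ire e p : src e = w -> e \notin F -> p \in A ->
    ideal_set I (r p *: ledge R e).
  move=> ew eF pA; have [pp rp] := wA p pA.
  have := idealMl (path_star R p.1 p.2) (Ixe e ((size p.2)%:Z + 1) ew).
  rewrite xe (negbTE eF) addr0 yE lmul_suml lproj_sum lmul_sumr.
  congr (ideal_set I _); rewrite (big_fsetD1 p) //= big_seq big1 => [|q].
    rewrite lscaleAl lprojZ lscaleAr addr0; congr (_ *: _).
    rewrite (lproj_comp _ (comp_M (path_elt_comp _ _ _) (comp_e R e))) eqxx.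
    by rewrite lmulA path_starK // rp -ew lse.
  rewrite in_fsetD1 => /andP[qp qA]; rewrite lscaleAl lprojZ lscaleAr.
  rewrite (lproj_comp _ (comp_M (path_elt_comp _ _ _) (comp_e R e))).
  rewrite (inj_eq (addIr _)) eqz_nat; case: eqP => [pq|_]; last first.
    by rewrite lmul0r scaler0.
  have neq (T : Type) (t : T) (s s' : seq T) : size s <> size (s ++ t :: s').
    by rewrite size_cat => /eqP; rewrite -[X in X == _]addn0 eqn_add2l.
  case: (path_star_elt_cases (wA p pA) (wA q qA) qp)
    => [|[f [gs [_ pE _ _]]]|s0].
  - by move=> [f [gs [_ qE _ _ _]]]; case: (@neq _ f p.2 gs); rewrite -qE.
  - by case: (@neq _ f q.2 gs); rewrite -pE.
  - by rewrite lmulA s0 lmul0l scaler0.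
pose d := ghost_defect w F.
have xd : x ** d = y ** d.
  rewrite xE lmulDl lmul_suml big_seq big1 ?addr0 // => f fF.
  by rewrite -lmulA ghost_defect0 ?lmul0r.
(* The element $dp^*xd=dp^*yd$ has the term $r_pd$. In the term of another path $q$ either $p^*q=0$,
   or the first edge $f$ of the remaining closed path meets $d$: it is killed if it lies in [F], and
   $r_qf$ lies in [I] otherwise. *)
have Ird p : p \in A -> ideal_set I (r p *: d).
  move=> pA; have [pp rp] := wA p pA.
  have := idealMl d (idealMl (path_star R p.1 p.2) (Defs.idealMr d Ix)).
  rewrite xd yE lmul_suml !lmul_sumr (big_fsetD1 p) //= lscaleAl !lscaleAr.
  rewrite (lmulA (path_star R _ _)) path_starK // rp lmulA.
  rewrite defect_vert // defect_idem //.
  set S := (X in _ + X) => Ipd; suff IS : ideal_set I S.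
    by rewrite -[_ *: _](addrK S); apply: idealB.
  rewrite /S big_seq; apply: big_ind => [||q]; [exact: ideal0|exact: idealD|].
  rewrite in_fsetD1 => /andP[qp qA]; rewrite lscaleAl !lscaleAr.
  rewrite (lmulA (path_star R _ _)) lmulA.
  case: (path_star_elt_cases (wA p pA) (wA q qA) qp)
    => [[f [gs [_ _ fw _ ->]]]|[f [gs [_ _ fw ->]]]|->].
  - have [fF|fF] := boolP (f \in F).
      rewrite path_elt_cons lmulA defect_edge // !lmul0l scaler0.
      exact: ideal0.
    rewrite -lscaleAl; apply: Defs.idealMr; apply: scale_edge_path.
    by rewrite -lscaleAr; apply/idealMl/Ire.
  - rewrite path_star_cons -!lmulA -lscaleAr -lscaleAr; do 2 apply: idealMl.
    have [fF|fF] := boolP (f \in F).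
      by rewrite ghost_defect0 // scaler0; exact: ideal0.
    rewrite -lscaleAl; apply: Defs.idealMr.
    (* Writing $f^*=f^*ff^*$ transfers the membership from $r_qf$ to $r_qf^*$. *)
    rewrite -(lrg R f) -lee -lmulA -lscaleAr -lscaleAl.
    by apply/idealMl/Defs.idealMr/Ire.
  - by rewrite lmul0r lmul0l scaler0; exact: ideal0.
move=> n; have -> : x = x ** d + \sum_(f <- F) x ** ledge R f ** lghost R f.
  rewrite lmulBr xw lmul_sumr; under [X in _ - X]eq_bigr do rewrite lmulA.
  by rewrite subrK.
rewrite lprojD lproj_sum; apply: idealD; last first.
  apply: ideal_sum => f /wF1 fw; rewrite (lprojMr _ _ (comp_g R f)).
  exact/Defs.idealMr/Ixe.
rewrite xd yE lmul_suml lproj_sum; apply: ideal_sum => p pA.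
rewrite lscaleAl lprojZ.
rewrite (lproj_comp _ (comp_M (path_elt_comp _ _ _) (defect_comp w F))).
case: eqP => _; last by rewrite scaler0; exact: ideal0.
by rewrite -lscaleAr; apply/idealMl/Ird.
Qed.

End Reduction.

(** * Laurent polynomials and the correspondence *)

Section LaurentIdeals.
Context (R : comPzRingType).
Implicit Types (p q : laurent R) (J : ring_ideal (laurent R)).

Definition laurent_homog p : {fsfun int -> laurent R with 0} :=
  [fsfun n in msupp p => << p@_n *g n >>].

Lemma laurent_homogE p n : laurent_homog p n = << p@_n *g n >>.
Proof.
by rewrite fsfunE; case: ifP => // /negbT /mcoeff_outdom ->; rewrite monalgU0.
Qed.

Lemma graded_laurent J : graded (@laurent_comp R) (ideal_set J) <->
  forall n p, ideal_set J p -> ideal_set J << p@_n *g n >>.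
Proof.
have -> : (forall n p, ideal_set J p -> ideal_set J << p@_n *g n >>) =
    (forall n p, ideal_set J p -> ideal_set J (laurent_homog p n)).
  by apply: eq_forall => n; apply: eq_forall => p; rewrite laurent_homogE.
apply: graded_projP => [p n|p|y Cy].
- by rewrite laurent_homogE; exists p@_n.
- rewrite (big_fset_incl _ (finsupp_sub _ _ _)) => [|n _ ny]; last first.
    by rewrite fsfun_dflt.
  by rewrite [LHS]monalgE; apply: eq_bigr => n _; rewrite laurent_homogE.
apply/fsfunP => m; rewrite laurent_homogE raddf_sum.
have [my|my] := boolP (m \in finsupp y).
  rewrite (big_fsetD1 m) //= big_seq big1 ?addr0 => [|n].
    by have [a ->] := Cy m; rewrite mcoeffUU.
  rewrite in_fsetD1 => /andP[/negbTE nm _].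
  by have [a ->] := Cy n; rewrite mcoeffU nm.
rewrite big_seq big1 ?monalgU0 ?fsfun_dflt // => n ny.
have [a ya] := Cy n; rewrite ya /= mcoeffU; case: eqP => // nm.
by rewrite -nm ny in my.
Qed.

(** Each monomial $a_nx^n$ is a multiple of the constant $a_n$. *)
Lemma laurent_over_ideal J p :
  (forall n, ideal_set J (laurentC p@_n)) -> ideal_set J p.
Proof.
move=> Jp; rewrite (monalgE p); apply: ideal_sum => n _.
suff -> : << p@_n *g n >> = (laurentC p@_n : laurent R) * << 1 *g n >>.
  exact: Defs.idealMr.
by rewrite [RHS]laurent_mulU mulr1 add0r.
Qed.

(** The monomial $x^n$ is invertible. *)
Lemma laurent_shift J a n :
  ideal_set J << a *g n >> -> ideal_set J (laurentC a).
Proof.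
move=> Ja; suff -> : laurentC a = (<< a *g n >> : laurent R) * << 1 *g - n >>.
  exact: Defs.idealMr.
by rewrite [RHS]laurent_mulU mulr1 subrr.
Qed.

End LaurentIdeals.

(** * Values of Laurent polynomials at a cycle *)

Section CycleEval.
Context (R : comPzRingType) (E : digraph).
Local Notation "x ** y" := (leavitt_mul x y) (at level 40, left associativity).
Local Notation comp := (@leavitt_comp R E).
Implicit Types (c : vert E * seq (edge E)) (w : vert E) (cs : seq (edge E)).

Lemma cycle_evalw c (p : laurent R) (D : {fset int}) : (msupp p `<=` D)%fset ->
  cycle_eval c p = \sum_(n <- D) p@_n *: cycle_pow R c n.
Proof.
move=> sD; rewrite /cycle_eval (big_fset_incl _ sD) //=.
by move=> n _ /mcoeff_outdom ->; rewrite scale0r.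
Qed.

Lemma cycle_evalU c a n :
  cycle_eval c (<< a *g n >> : laurent R) = a *: cycle_pow R c n.
Proof. by rewrite (cycle_evalw c msuppU_le) big_seq_fset1 mcoeffUU. Qed.

Lemma cycle_evalD c (p q : laurent R) :
  cycle_eval c (p + q) = cycle_eval c p + cycle_eval c q.
Proof.
rewrite (cycle_evalw c (msuppD_le p q)) (cycle_evalw c (fsubsetUl _ (msupp q))).
rewrite (cycle_evalw c (fsubsetUr (msupp p) _)) -big_split.
by apply: eq_bigr => n _; rewrite mcoeffD scalerDl.
Qed.

Lemma cycle_eval_sum c (T : Type) (s : seq T) (F : T -> laurent R) :
  cycle_eval c (\sum_(i <- s) F i) = \sum_(i <- s) cycle_eval c (F i).
Proof.
apply: (big_morph (cycle_eval c)) => [p q|]; first exact: cycle_evalD.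
by rewrite /cycle_eval msupp0 big_seq_fset0.
Qed.

Lemma cycle_powP w cs (n : nat) : path_to w (w, cs) ->
  cycle_pow R (w, cs) n = path_elt R w (seq_pow cs n).
Proof.
move=> wcs; have [/= pcs rcs] := wcs; case: n => // n.
rewrite /cycle_pow iteropS; elim: n => [|n IH] /=.
  by rewrite /seq_pow /= cats0.
rewrite IH (seq_powS _ n.+1) path_elt_cat ?rcs //.
by have [] := loop_pow n.+1 wcs.
Qed.

Lemma cycle_powN w cs (n : nat) : path_to w (w, cs) ->
  cycle_pow R (w, cs) (- n%:Z) = path_star R w (seq_pow cs n).
Proof.
move=> wcs; have [/= pcs rcs] := wcs; case: n => // n.
rewrite -NegzE /cycle_pow iteropS; elim: n => [|n IH] /=.
  by rewrite /seq_pow /= cats0.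
have [/= pn rn] := loop_pow n.+1 wcs.
rewrite IH -[in RHS]addn1 seq_powD path_star_cat ?rn /seq_pow /= cats0 //.
Qed.

Lemma cycle_pow_comp w cs n : path_to w (w, cs) ->
  comp (n * (size cs)%:Z) (cycle_pow R (w, cs) n).
Proof.
move=> wcs; case: n => k.
  by rewrite cycle_powP // -PoszM -size_seq_pow; apply: path_elt_comp.
rewrite NegzE cycle_powN // mulNr -PoszM -size_seq_pow.
exact: path_star_comp.
Qed.

(** A power of $c$ is cancelled by its star on the left, a power of $c^*$ by the same power of $c$
    on the right. *)
Lemma cycle_pow_vert (I : leavitt_ideal R E) w cs a n : path_to w (w, cs) ->
  ideal_set I (a *: cycle_pow R (w, cs) n) -> ideal_set I (a *: lvert R w).
Proof.
move=> wcs; case: n => k; rewrite ?NegzE (cycle_powP, cycle_powN) // => Ia.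
  have [/= pk rk] := loop_pow k wcs; rewrite -{1}rk -path_starK // -lscaleAr.
  exact: idealMl.
have [/= pk rk] := loop_pow k.+1 wcs; rewrite -{1}rk -path_starK // -lscaleAl.
exact: Defs.idealMr.
Qed.

End CycleEval.

(** * Passing between the pair $(f,g)$ and the ideal $I$ *)

Section Correspondence.
Local Open Scope quotient_scope.
Context (R : comPzRingType) (E : digraph) (f : adm_nz E -> ring_ideal R)
  (g : Cu E -> ring_ideal (laurent R)) (I : leavitt_ideal R E).
Context (fgD : in_D f g) (fgI : corresponds f g I).
Local Notation "x ** y" := (leavitt_mul x y) (at level 40, left associativity).
Implicit Types (c : Cu E) (p : laurent R).

Lemma mem_g c p : ideal_set (g c) p <-> ideal_set I (cycle_eval (cu_repr c) p).
Proof. by have [_ /(_ c) ->] := fgI. Qed.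

Lemma mem_gC c (a : R) :
  ideal_set (g c) (laurentC a) <-> ideal_set (f (cu_closure c)) a.
Proof. by have [_ /(_ c)[<- _]] := fgD. Qed.

Lemma cu_repr_loop c :
  path_to (cu_repr c).1 (cu_repr c) /\ (cu_repr c).2 <> [::].
Proof. by rewrite /cu_repr; case: (repr c) => d /= /asboolP[[[]]]. Qed.

(** This inclusion holds for every pair in $\mathscr{D}_{E,R}$, so that (2) amounts to the reverse
    one. *)
Lemma laurent_over_sub c :
  laurent_over (ideal_set (f (cu_closure c))) `<=` ideal_set (g c).
Proof. by move=> p fp; apply: laurent_over_ideal => n; apply/mem_gC. Qed.

(** A graded ideal contains the monomials of its elements and, $x$ being invertible, their
    coefficients. Thus (2) and (3) agree class by class. *)
Lemma graded_g_iff c :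
  ideal_set (g c) = laurent_over (ideal_set (f (cu_closure c))) <->
  graded (@laurent_comp R) (ideal_set (g c)).
Proof.
split=> [gE|/graded_laurent gg].
  apply/graded_laurent => n p; rewrite gE => fp k; rewrite mcoeffU.
  by case: eqP => _; rewrite ?mulr1n ?mulr0n //; exact: ideal0.
apply/seteqP; split=> [p gp n|]; last exact: laurent_over_sub.
exact/mem_gC/laurent_shift/gg.
Qed.

(** As $c$ has positive length, the terms $a_nc^n$ of $p(c)$ have distinct degrees $n|c|$. They are
    its components, and each yields $a_n$ times the base vertex. *)
Lemma graded_g_coef : graded (@leavitt_comp R E) (ideal_set I) ->
  forall c, ideal_set (g c) = laurent_over (ideal_set (f (cu_closure c))).
Proof.
move=> /graded_lproj gI c; apply/seteqP.
split=> [p|]; last exact: laurent_over_sub.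
move=> /mem_g Ip n; apply/mem_gC/mem_g.
have [] := cu_repr_loop c; move: (cu_repr c) Ip => [w cs] /= Ip wcs cs0.
rewrite cycle_evalU; apply: (@cycle_pow_vert _ _ _ _ cs _ n) => //.
have := gI (n * (size cs)%:Z) _ Ip; congr (ideal_set I _).
(* The index [n] is adjoined because it may lie outside the support of [p]. *)
rewrite (cycle_evalw _ (fsubsetUl (msupp p) [fset n]%fset)) lproj_sum.
rewrite (big_fsetD1 n) /=; last by rewrite in_fsetU in_fset1 eqxx orbT.
rewrite lprojZ (lproj_comp _ (cycle_pow_comp _ _ wcs)) eqxx.
rewrite big_seq big1 ?addr0 // => k.
rewrite in_fsetD1 => /andP[kn _].
rewrite lprojZ (lproj_comp _ (cycle_pow_comp _ _ wcs)).
rewrite (inj_eq (mulIf _)) ?eqz_nat //; last by case: (cs) cs0.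
by rewrite eq_sym (negbTE kn) scaler0.
Qed.

(** The cycle [cs] is a rotation of the representative of its class. Conjugation by the initial
    segment [al] of [cs] moves the polynomial to the representative, where (2) applies. *)
Lemma coef_cycle_constant_terms :
  (forall c, ideal_set (g c) = laurent_over (ideal_set (f (cu_closure c)))) ->
  cycle_constant_terms I.
Proof.
move=> gE w cs cyc uniq_c a s s_gt0 Is; have [[/= pcs cs0 rcs] _] := cyc.
pose C : cu_cycle E := exist _ (w, cs) (asboolT (conj cyc uniq_c)).
pose c : Cu E := \pi_(Cu E) C.
have [k ck] : exists k, (cu_repr c).2 = rot k cs.
  have /eqP : \pi_(Cu E) C = \pi_(Cu E) (repr c) by rewrite reprK.
  by rewrite eqmodE => /asboolP.
have [[/= pd rd] d0] := cu_repr_loop c.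
set v := (cu_repr c).1 in pd rd; set ds := (cu_repr c).2 in ck pd rd d0.
pose al := take k cs; pose be := drop k cs.
have csE : cs = al ++ be by rewrite cat_take_drop.
have dsE : ds = be ++ al by [].
have [pal pbe] : is_path w al /\ is_path (path_rng w al) be.
  by apply/is_path_cat; rewrite -csE.
have alv : path_rng w al = v.
  by apply: (@loop_rot_base _ w _ al be); rewrite -?csE -?dsE //; split.
have wds : path_to v (v, ds) by [].
pose p : laurent R := << a *g 0 >> + \sum_(i <- s) << i.1 *g i.2%:Z >>.
have gp : ideal_set (g c) p.
  apply/mem_g; rewrite [cu_repr c]surjective_pairing -/v -/ds.
  have := Defs.idealMr (path_elt R w al) (idealMl (path_star R w al) Is).
  congr (ideal_set I _).
  (* With $c=\alpha\beta$ and $d=\beta\alpha$ one has $c^n\alpha=\alpha d^n$, and $\alpha^*$ cancels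
     $\alpha$. *)
  have conj_al n :
      path_star R w al ** path_elt R w (seq_pow cs n) ** path_elt R w al =
      path_elt R v (seq_pow ds n).
    have [/= pn _] := loop_pow n wds.
    have [/= _ rcn] := loop_pow n (conj pcs rcs : path_to w (w, cs)).
    rewrite -lmulA -[in X in _ ** (_ ** X)]rcn -path_elt_cat ?rcn // csE.
    rewrite -seq_pow_rot -dsE path_star_elt_cat ?alv //.
    by apply/is_path_cat; rewrite alv.
  rewrite lmulDr lmulDl lscaleAr lscaleAl (conj_al 0%N) lmul_sumr lmul_suml.
  rewrite cycle_evalD cycle_evalU cycle_eval_sum; congr (_ + _).
  apply: eq_bigr => i _; rewrite lscaleAr lscaleAl conj_al cycle_evalU.
  by rewrite cycle_powP.
have fa : ideal_set (f (cu_closure c)) a.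
  (* The exponents in [s] are positive, so [a] is the constant coefficient of [p]. *)
  move: gp; rewrite gE => /(_ 0); congr (ideal_set _ _).
  rewrite mcoeffD mcoeffUU raddf_sum big_seq big1 ?addr0 // => i /s_gt0 /=.
  by rewrite mcoeffU; case: (i.2) => // m _; rewrite mulr0n.
have [/(_ (cu_closure c)) fE _] := fgI.
move: fa; rewrite fE => -[/(_ w) fw _]; apply: fw.
(* The vertex $w$ is the range of the last edge of [cs], which also occurs in the rotation. *)
apply: sub_hs_closure; right; rewrite -/ds ck.
case/lastP: (cs) cs0 rcs => // t e _.
rewrite /path_rng map_rcons last_rcons => ew.
by exists e; rewrite // mem_rot mem_rcons mem_head.
Qed.

End Correspondence.

(** An element of [I] is a finite sum of products $xw$, each of which lies in [I] and in some
    [ghost_span]. *)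
Lemma graded_cycle_constant_terms (R : comPzRingType) (E : digraph)
    (I : leavitt_ideal R E) : cycle_constant_terms I ->
  graded (@leavitt_comp R E) (ideal_set I).
Proof.
move=> HI; apply/graded_lproj => n x Ix; have [W xW] := right_units x.
rewrite (xW W) // lproj_sum; apply: ideal_sum => w _.
have [N xN] := ghost_span_vert x w.
by apply: (graded_ghost_span HI xN); apply: Defs.idealMr.
Qed.

Theorem theorem6p26 (R : comPzRingType) (E : digraph)
    (f : adm_nz E -> ring_ideal R) (g : Cu E -> ring_ideal (laurent R))
    (I : leavitt_ideal R E) :
  in_D f g -> corresponds f g I ->
  (graded (@leavitt_comp R E) (ideal_set I) <->
     (forall c : Cu E,
        ideal_set (g c) = laurent_over (ideal_set (f (cu_closure c))))) /\
  ((forall c : Cu E,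
      ideal_set (g c) = laurent_over (ideal_set (f (cu_closure c)))) <->
     (forall c : Cu E, graded (@laurent_comp R) (ideal_set (g c)))).
Proof.
move=> fgD fgI; split; last by split=> gE c; apply/(graded_g_iff fgD).
split=> [gI|gE]; first exact: graded_g_coef fgD fgI gI.
exact/graded_cycle_constant_terms/(coef_cycle_constant_terms fgI gE).
Qed.
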